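(* Let $G$ be a countable group with a nonelementary action by isometries on a separable hyperbolic metric space $X$. Let $\mu$ be a nonelementary probability measure on $G$ (with respect to this action), let $k\ge 1$ be an integer, and fix $x_0\in X$. Let $(w^1_n)_{n\in\mathbb{N}},\ldots,(w^k_n)_{n\in\mathbb{N}}$ be $k$ independent random walks on $G$ whose increments are distributed according to $\mu$, and let $\Gamma(n)=\langle w^1_n,\ldots,w^k_n\rangle\le G$. Then the probability that the orbit map $$\Gamma(n)\to X,\qquad g\mapsto g\cdot x_0$$ is a quasi-isometric embedding tends to $1$ as $n\to\infty$.
   Context: For points $x,y,z$ of a metric space $X$, the Gromov product is $(y\cdot z)_x=\frac12\big(d(x,y)+d(x,z)-d(y,z)\big)$. $X$ is $\delta$-hyperbolic if $(x\cdot y)_w\ge\min\{(x\cdot z)_w,(z\cdot y)_w\}-\delta$ for all $x,y,z,w\in X$, and hyperbolic if it is $\delta$-hyperbolic for some $\delta\ge0$. An isometry $g$ of $X$ is loxodromic if it has positive translation length, i.e. $\liminf_{n\to\infty} d(x_0,g^nx_0)/n>0$ for some $x_0\in X$. An action of $G$ on $X$ by isometries is nonelementary if there are $g,h\in G$ acting loxodromically on $X$ whose fixed point sets on the Gromov boundary $\partial X$ are disjoint (so together they determine $4$ distinct points of $\partial X$). A probability measure $\mu$ on $G$ is nonelementary (with respect to the action) if the semigroup generated by the support of $\mu$ is a subgroup of $G$ whose action on $X$ is nonelementary. A random walk on $G$ with increments distributed according to $\mu$ is the sequence $w_n=g_1g_2\cdots g_n$, where $(g_i)_{i\ge1}$ are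 independent $G$-valued random variables each with distribution $\mu$. The group $\Gamma(n)$ is endowed with the word metric coming from the finite generating set $w^1_n,\ldots,w^k_n$. The quasi-isometry constants may depend on $n$ and on the sample. *)

(* Defs.v *)
From HB Require Import structures.
From mathcomp Require Import all_boot all_order all_algebra finmap.
From mathcomp Require Import all_classical all_reals all_analysis.

Set Implicit Arguments.
Unset Strict Implicit.
Unset Printing Implicit Defensive.

Import Order.TTheory GRing.Theory Num.Theory.
Import numFieldNormedType.Exports.

Local Open Scope classical_set_scope.
Local Open Scope ring_scope.

Definition separable_space (X : topologicalType) : Prop :=
  exists D : set X, countable D /\ dense D.

(** [gromov_product x y z] is $(y\cdot z)_x$: the base point comes first. *)
Definition gromov_product (R : realType) (X : metricType R) (x y z : X) : R :=
  (mdist x y + mdist x z - mdist y z) / 2.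

Definition delta_hyperbolic (R : realType) (X : metricType R) (delta : R) :
    Prop :=
  forall x y z w : X,
    Num.min (gromov_product w x z) (gromov_product w z y) - delta
      <= gromov_product w x y.

Definition hyperbolic (R : realType) (X : metricType R) : Prop :=
  exists delta : R, 0 <= delta /\ delta_hyperbolic X delta.

(** $(u_m\cdot v_n)_w\to\infty$ as $m,n\to\infty$.  The condition does not
    depend on the base point $w$, so quantifying over it is harmless. *)
Definition gromov_equiv (R : realType) (X : metricType R) (u v : nat -> X) :
    Prop :=
  forall (w : X) (M : R),
    \forall m & n \near \oo, M <= gromov_product w (u m) (v n).

Definition gromov_sequence (R : realType) (X : metricType R) (u : nat -> X) :
    Prop :=
  gromov_equiv u u.

(** $X$ is not assumed proper or geodesic, so $\partial X$ is the sequential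
    boundary; a boundary point is an equivalence class of Gromov sequences. *)
Definition gromov_boundary (R : realType) (X : metricType R) :
    set (set (nat -> X)) :=
  [set [set v | gromov_sequence v /\ gromov_equiv u v]
     | u in [set u | gromov_sequence u]].

(** For a bijective isometry [f] the image of a class is again a class. *)
Definition boundary_map (X : Type) (f : X -> X) (xi : set (nat -> X)) :
    set (nat -> X) :=
  [set f \o u | u in xi].

Definition boundary_fixed_points (R : realType) (X : metricType R)
    (f : X -> X) : set (set (nat -> X)) :=
  [set xi | @gromov_boundary R X xi /\ boundary_map f xi = xi].

Definition isometric_action (R : realType) (G : groupType) (X : metricType R)
    (act : G -> X -> X) : Prop :=
  [/\ forall x, act 1%g x = x,
      forall g h x, act (g * h)%g x = act g (act h x) &
      forall g x y, mdist (act g x) (act g y) = mdist x y].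

(** The term at [n = 0] is a division by zero; it does not affect the
    inferior limit. *)
Definition loxodromic (R : realType) (X : metricType R) (f : X -> X) : Prop :=
  exists x : X,
    (0 < limn_einf (fun n => (mdist x (iter n f x) / n%:R)%:E))%E.

(** Nonelementarity of the restriction of the action to the subgroup [H]. *)
Definition nonelementary_action (R : realType) (G : groupType)
    (X : metricType R) (act : G -> X -> X) (H : set G) : Prop :=
  exists g h : G,
    [/\ H g, H h, loxodromic (act g), loxodromic (act h) &
        boundary_fixed_points (act g) `&` boundary_fixed_points (act h)
          = set0].

Definition subsemigroup (G : groupType) (S : set G) : Prop :=
  forall g h, S g -> S h -> S (g * h)%g.

Definition subgroup (G : groupType) (S : set G) : Prop :=
  [/\ S 1%g, forall g h, S g -> S h -> S (g * h)%g &
      forall g, S g -> S (g^-1)%g].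

Definition generated_semigroup (G : groupType) (S : set G) : set G :=
  smallest (@subsemigroup G) S.

Definition generated_subgroup (G : groupType) (S : set G) : set G :=
  smallest (@subgroup G) S.

(** The lengths of the words in [S] and inverses of elements of [S] that
    represent [g]; for [g] in the subgroup generated by [S] this set is nonempty
    and its infimum is a minimum. *)
Definition word_length (R : realType) (G : groupType) (S : set G) (g : G) : R :=
  inf [set (size s)%:R
     | s in [set s : seq G | (forall x, x \in s -> S x \/ S (x^-1)%g) /\
                             (\prod_(x <- s) x)%g = g]].

Definition word_metric (R : realType) (G : groupType) (S : set G) (g h : G) : R :=
  word_length R S (g^-1 * h)%g.

Definition quasi_isometric_embedding (R : realType) (Y : Type)
    (X : metricType R) (A : set Y) (dA : Y -> Y -> R) (f : Y -> X) : Prop :=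
  exists K C : R, [/\ 1 <= K, 0 <= C &
    forall a b, A a -> A b ->
      K^-1 * dA a b - C <= mdist (f a) (f b) <= K * dA a b + C].

Definition discrete_group (G : groupType) : Type := G.

HB.instance Definition _ (G : groupType) := Group.on (discrete_group G).
HB.instance Definition _ (G : groupType) :=
  isPointed.Build (discrete_group G) (1%g : G).
HB.instance Definition _ (G : groupType) :=
  @isMeasurable.Build default_measure_display (discrete_group G)
    discrete_measurable discrete_measurable0
    discrete_measurableC discrete_measurableU.

Definition measure_support (R : realType) (G : groupType)
    (mu : probability (discrete_group G) R) : set G :=
  [set g | (0 < mu [set g])%E].

Definition nonelementary_measure (R : realType) (G : groupType)
    (X : metricType R) (act : G -> X -> X)
    (mu : probability (discrete_group G) R) : Prop :=
  subgroup (generated_semigroup (measure_support mu)) /\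
  nonelementary_action act (generated_semigroup (measure_support mu)).

Definition mutually_independent (d : measure_display) (R : realType)
    (Omega : measurableType d) (P : probability Omega R)
    (I : choiceType) (F : I -> set_system Omega) : Prop :=
  forall (J : {fset I}) (A : I -> set Omega),
    (forall i, i \in J -> F i (A i)) ->
    P (\bigcap_(i in [set` J]) A i) = (\prod_(i <- J) P (A i))%E.

(** The family [g] is indexed from $0$: [g i] is the increment $g_{i+1}$, so
    that $w_n=g_1\cdots g_n$ and [w 0 = 1]. *)
Definition random_walk (d : measure_display) (R : realType) (G : groupType)
    (Omega : measurableType d) (P : probability Omega R)
    (mu : probability (discrete_group G) R)
    (w : nat -> Omega -> discrete_group G) : Prop :=
  exists g : nat -> {RV P >-> discrete_group G},
    [/\ mutually_independent P (fun i => g_sigma_algebra_preimage (g i)),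
        forall i, distribution P (g i) =1 mu &
        forall n omega, w n omega = (\prod_(0 <= i < n) g i omega)%g].

Definition process_sigma_algebra (d : measure_display) (G : groupType)
    (Omega : measurableType d) (w : nat -> Omega -> discrete_group G) :
    set_system Omega :=
  <<s \bigcup_n g_sigma_algebra_preimage (w n) >>.

Definition independent_processes (d : measure_display) (R : realType)
    (G : groupType) (Omega : measurableType d) (P : probability Omega R)
    (k : nat) (w : 'I_k -> nat -> Omega -> discrete_group G) : Prop :=
  mutually_independent P (fun j => process_sigma_algebra (w j)).

(* Main.v *)
Require Import Defs.
From HB Require Import structures.
From mathcomp Require Import all_boot all_order all_algebra finmap.
From mathcomp Require Import all_classical all_reals all_analysis.
From mathcomp Require Import ring lra.

Set Implicit Arguments.
Unset Strict Implicit.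
Unset Printing Implicit Defensive.

Import Order.TTheory GRing.Theory Num.Theory.
Import numFieldNormedType.Exports.

Local Open Scope classical_set_scope.
Local Open Scope ring_scope.

(** Write $o$ for the base point and $|g|=d(o,go)$.  If every letter $u$ among
    the $w^j_n$ and their inverses has $|u|\ge L$, if $(uo\cdot vo)_o\le M$ for
    distinct letters $u\ne v$, and if $L\ge 2M+3\delta+1$, then a reduced word
    in these letters traces a broken path whose corners are negligible against
    its sides.  Such a path is a quasi-geodesic
    ([broken_geodesic_length]), so the orbit map is a quasi-isometric embedding
    ([separated_quasi_isometric_embedding]).  It remains to see that these
    inequalities hold with probability close to $1$: for every
    $\varepsilon>0$ there is one $M$ for which the bound on the Gromov products
    fails with probability at most $\varepsilon$ for all large $n$, and for
    every $L$ the probability of $|w_n|\le L$ tends to $0$.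

    Both facts are instances of a single concentration estimate
    ([concentration]), which replaces the convergence of the walk to the
    boundary: for all $\varepsilon>0$ and $L$ there is $M$ such that, for all
    large $n$ and uniformly in $y\in X$,
    $$P\big((w_no\cdot y)_o>M\ \text{or}\ d(w_no,y)\le L\big)\le\varepsilon.$$
    Its proof is the usual argument for the absence of atoms of a stationary
    measure, carried out at finite times and without any limit object.  Let $c$
    be a bound, for large $n$ and some $M$, of the probability above.
    Conditioning on the first $r$ steps bounds the probability at time $r+n$ by
    the average over $u$ of the probability at time $n$ for the point
    $u^{-1}y$, with $M$ diminished by $|u|$.  Suppose that finitely many $u$,
    each charged by $\mu^{*r}$, send $y$ to pairwise separated points
    $u^{-1}y$.  The corresponding events are then disjoint, so one of them has
    small probability, and the average is at most $c-\eta$, where $\eta$ stays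
    away from $0$ as long as $c\ge\varepsilon$.  Finitely many steps lead from
    $c=1$ to $c=\varepsilon$ ([rarely_near_contract]).

    The elements $u^{-1}$ are positive words of a fixed length in large powers
    of two loxodromic isometries: the disjointness of the fixed points at
    infinity makes suitable powers play ping-pong
    ([loxodromic_schottky_pair], [schottky_words_separated]), and the
    exponents can be matched so that the inverses of all these words are charged
    at the same time $r$ ([spreading_words]).  The walk has to charge inverses
    of the loxodromic elements, which is the point where the semigroup generated
    by the support has to be a group.  The same property makes the estimate
    available for $w_n^{-1}$.

    For two independent walks the required bound on Gromov products follows by
    conditioning on one of them.  For $w_n$ and $w_n^{-1}$, cut the walk in the
    middle, $w_n=uv$ with $u$ and $v$ independent: up to $2\delta$, the product
    $(w_no\cdot w_n^{-1}o)_o$ is controlled by $(uo\cdot v^{-1}o)_o$ as soon as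
    $(u^{-1}o\cdot vo)_o$ is bounded and $|u|,|v|$ are large
    ([gromov_product_inverse_le]). *)

(** * Gromov products and broken geodesics *)

Section gromov_product.
Context (R : realType) (X : metricType R).
Implicit Types w x y z : X.

Lemma gromov_productC w x y : gromov_product w x y = gromov_product w y x.
Proof. by rewrite /gromov_product (metric_sym y x) (addrC (mdist w y)). Qed.

Lemma gromov_product_ge0 w x y : 0 <= gromov_product w x y.
Proof.
have := metric_triangle x w y; rewrite (metric_sym x w) /gromov_product;
  intros; lra.
Qed.

Lemma gromov_product_le_mdist w x y : gromov_product w x y <= mdist w x.
Proof. have := metric_triangle w x y; rewrite /gromov_product; intros; lra. Qed.

Lemma gromov_product_base w w' x y :
  gromov_product w x y <= gromov_product w' x y + mdist w w'.
Proof.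
have := metric_triangle w w' x; have := metric_triangle w w' y.
rewrite /gromov_product; intros; lra.
Qed.

Lemma gromov_product_move w x y z :
  gromov_product w x y <= gromov_product w x z + mdist y z.
Proof.
have := metric_triangle w z y; have := metric_triangle x y z.
rewrite /gromov_product (metric_sym z y); intros; lra.
Qed.

Lemma gromov_product_switch w x y :
  gromov_product w x y = mdist w x - gromov_product x w y.
Proof. rewrite /gromov_product (metric_sym x w); intros; lra. Qed.

Lemma mdist_gromov_product w x y :
  mdist x y = mdist w x + mdist w y - 2 * gromov_product w x y.
Proof. rewrite /gromov_product; intros; lra. Qed.

(** The two cases of the minimum, in the form in which linear arithmetic can use
    them. *)
Lemma four_point (delta : R) (hypX : delta_hyperbolic X delta) w x y z :
  gromov_product w x z - delta <= gromov_product w x y \/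
  gromov_product w z y - delta <= gromov_product w x y.
Proof.
have := hypX x y z w; rewrite /Num.min.
by case: ifP => _ ?; [left|right].
Qed.

(** Local-to-global principle. A small turn at [x i.+1], seen from [x 0], and a
    last step of length at least [L] mean that from [x i.+2] the points [x 0]
    and [x i.+1] lie in almost the same direction: their product is at least
    $L-M-\delta$. The four-point inequality then transfers the bound [M] on the
    turn from [x i.+1] to [x 0] with the loss of a single [delta], which does
    not accumulate. *)
Lemma broken_geodesic_turn (delta M L : R) (x : nat -> X) n :
    delta_hyperbolic X delta -> 0 <= delta -> 2 * M + 3 * delta + 1 <= L ->
    (forall i, (i < n)%N -> L <= mdist (x i) (x i.+1)) ->
    (forall i, (i.+1 < n)%N -> gromov_product (x i.+1) (x i) (x i.+2) <= M) ->
  forall i, (i.+1 < n)%N ->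
    gromov_product (x i.+1) (x 0%N) (x i.+2) <= M + delta.
Proof.
move=> hypX delta_ge0 ML xL xM; elim=> [|i IH] in_; first by have := xM _ in_;
  intros; lra.
have {}IH := IH (ltnW in_).
have := xL i.+1 (ltnW in_).
have := xM _ in_.
have := gromov_product_switch (x i.+2) (x i.+1) (x 0%N).
rewrite (gromov_productC (x i.+1)) (metric_sym (x i.+2) (x i.+1)).
have [] := four_point hypX (x i.+2) (x i.+1) (x i.+3) (x 0%N); intros; lra.
Qed.

(** Each new side adds at least $L-2(M+\delta)\ge1$ to the distance from the
    origin of the path. *)
Lemma broken_geodesic_length (delta M L : R) (x : nat -> X) n :
    delta_hyperbolic X delta -> 0 <= delta -> 0 <= M -> 2 * M + 3 * delta + 1
      <= L ->
    (forall i, (i < n)%N -> L <= mdist (x i) (x i.+1)) ->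
    (forall i, (i.+1 < n)%N -> gromov_product (x i.+1) (x i) (x i.+2) <= M) ->
  n%:R <= mdist (x 0%N) (x n).
Proof.
move=> hypX delta_ge0 M_ge0 ML xL xM.
have turn := broken_geodesic_turn hypX delta_ge0 ML xL xM.
elim: n xL xM turn => [|n IH] xL xM turn; first by rewrite mdistxx.
have {}IH : n%:R <= mdist (x 0%N) (x n).
  by apply: IH => i in_; [apply: xL|apply: xM|apply: turn]; rewrite ltnS ltnW.
have := xL n (ltnSn n); rewrite -natr1.
case: n IH turn {xL xM} => [|n] IH turn; first by rewrite !mulr0n; intros; lra.
have := turn _ (ltnSn _).
rewrite (mdist_gromov_product (x n.+1) (x 0%N) (x n.+2)).
rewrite (metric_sym (x n.+1) (x 0%N)).
by intros; lra.
Qed.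

(** From [x i], the end [x n] lies in almost the direction of [x i.+1], by the
    turn lemma for the reversed path; the turn lemma itself separates [x i.+1]
    from [x 0]. *)
Lemma broken_geodesic_inner (delta M L : R) (x : nat -> X) n :
    delta_hyperbolic X delta -> 0 <= delta -> 2 * M + 3 * delta + 1 <= L ->
    (forall i, (i < n)%N -> L <= mdist (x i) (x i.+1)) ->
    (forall i, (i.+1 < n)%N -> gromov_product (x i.+1) (x i) (x i.+2) <= M) ->
  forall i, (0 < i < n)%N ->
    gromov_product (x i) (x 0%N) (x n) <= M + 2 * delta.
Proof.
move=> hypX delta_ge0 ML xL xM [//|i] /andP[_ in_].
have turn := broken_geodesic_turn hypX delta_ge0 ML xL xM in_.
have [<-|n_neq] := eqVneq i.+2 n; first by lra.
have in2 : (i.+2 < n)%N by rewrite ltn_neqAle n_neq.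
pose x' j := x (n - j)%N.
have x'L j : (j < n)%N -> L <= mdist (x' j) (x' j.+1).
  by move=> jn; rewrite /x' -(subnSK jn) metric_sym; apply: xL;
    rewrite subnSK ?leq_subr.
have x'M j : (j.+1 < n)%N -> gromov_product (x' j.+1) (x' j) (x' j.+2) <= M.
  move=> jn; rewrite /x' -(subnSK (ltnW jn)) -(subnSK jn) gromov_productC.
  by apply: xM; rewrite !subnSK ?leq_subr// ltnW.
have := broken_geodesic_turn hypX delta_ge0 ML x'L x'M (i := n - i.+3).
rewrite /x' subn0 subnSK// -subSn// subSS !subKn ?(ltnW in_) ?(ltnW in2)//.
move/(_ (leq_subr _ _)).
have := gromov_product_switch (x i.+1) (x i.+2) (x n).
rewrite (gromov_productC (x i.+2) (x n)).
have := xL i.+1 (ltnW in2).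
rewrite (gromov_productC (x i.+1) (x i.+2)).
by have [] := four_point hypX (x i.+1) (x 0%N) (x i.+2) (x n); intros; lra.
Qed.

End gromov_product.

(** * A criterion for a quasi-isometric orbit map *)

Section isometric_action.
Context (R : realType) (G : groupType) (X : metricType R) (act : G -> X -> X).
Hypothesis actP : isometric_action act.
Implicit Types g h : G.

Lemma act1 x : act 1%g x = x. Proof. by case: actP. Qed.

Lemma actM g h x : act (g * h)%g x = act g (act h x). Proof. by case: actP. Qed.

Lemma mdist_act g x y : mdist (act g x) (act g y) = mdist x y.
Proof. by case: actP. Qed.

Lemma actK g x : act (g^-1)%g (act g x) = x.
Proof. by rewrite -actM mulVg act1. Qed.

Lemma actVK g x : act g (act (g^-1)%g x) = x.
Proof. by rewrite -actM mulgV act1. Qed.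

Lemma gromov_product_act g x y z :
  gromov_product (act g x) (act g y) (act g z) = gromov_product x y z.
Proof. by rewrite /gromov_product !mdist_act. Qed.

Lemma mdist_actV g x y : mdist x (act g y) = mdist (act (g^-1)%g x) y.
Proof. by rewrite -(mdist_act g^-1%g) actK. Qed.

Lemma iter_act n g x : iter n (act g) x = act (g ^+ n)%g x.
Proof. by elim: n => [|n IH] /=; rewrite ?act1// expgS actM IH. Qed.

Definition is_word (S : set G) (l : seq G) :=
  forall u, u \in l -> S u \/ S (u^-1)%g.

Lemma generated_subgroup_word (S : set G) g : generated_subgroup S g ->
  exists2 l, is_word S l & (\prod_(u <- l) u)%g = g.
Proof.
move=> Sg; apply: (Sg [set g | exists2 l, is_word S l & (\prod_(u <- l) u)%g =
  g]).
split=> [|h Sh]; last first.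
  exists [:: h]; last by rewrite big_seq1.
  by move=> x; rewrite inE => /eqP ->; left.
split=> [|_ _ [l Sl <-] [m Sm <-]|_ [l Sl <-]].
- by exists [::] => //; rewrite big_nil.
- exists (l ++ m); last by rewrite big_cat.
  by move=> x; rewrite mem_cat => /orP[/Sl|/Sm].
- exists (rev (map (fun u => u^-1)%g l)).
    by move=> x; rewrite mem_rev => /mapP[y /Sl Sy ->]; rewrite invgK;
      case: Sy; [right|left].
  elim: l {Sl} => [|x l IH]; first by rewrite !big_nil invg1.
  by rewrite /= rev_cons -cats1 big_cat big_seq1/= IH big_cons invgM.
Qed.

Lemma generated_subgroupP (S : set G) : subgroup (generated_subgroup S).
Proof.
split=> [A [[]//]|g h Sg Sh A AS|g Sg A AS].
- by have [_ + _] := AS.1; apply; [exact: Sg|exact: Sh].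
- by have [_ _] := AS.1; apply; exact: Sg.
Qed.

Lemma mdist_word_le (S : set G) (K : R) o l : is_word S l ->
    (forall g, S g -> mdist o (act g o) <= K) ->
  mdist o (act (\prod_(u <- l) u)%g o) <= K * (size l)%:R.
Proof.
move=> + SK; elim: l => [|x l IH] Sl; first by rewrite big_nil act1 mdistxx
  mulr0.
have {}IH := IH (fun y ly => Sl y (mem_behead (s := x :: l) ly)).
have xK : mdist o (act x o) <= K.
  have [/SK//|/SK] := Sl x (mem_head _ _).
  by rewrite mdist_actV invgK metric_sym.
rewrite big_cons actM (le_trans (metric_triangle _ (act x o) _))//.
by rewrite mdist_act/= -natr1 mulrDr mulr1 addrC lerD.
Qed.

(** The prefixes of a reduced word send the base point to the vertices of a
    broken path. After translation, the turn between consecutive letters $g,h$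
    is $(g^{-1}o\cdot ho)_o$, and reducedness says precisely that $g^{-1}\ne
    h$. *)
Lemma word_is_broken_geodesic (delta M : R) (S : set G) o (l : seq G) :
    delta_hyperbolic X delta -> 0 <= delta -> 0 <= M -> is_word S l ->
    (forall g, S g -> 2 * M + 3 * delta + 1 <= mdist o (act g o)) ->
    (forall g h, S g \/ S (g^-1)%g -> S h \/ S (h^-1)%g -> g != h ->
       gromov_product o (act g o) (act h o) <= M) ->
    (forall i, (i.+1 < size l)%N -> ((nth 1 l i)^-1 != nth 1 l i.+1)%g) ->
  (size l)%:R <= mdist o (act (\prod_(u <- l) u)%g o).
Proof.
move=> hypX delta_ge0 M_ge0 Sl SL SM reduced.
pose x i := act (\prod_(u <- take i l) u)%g o.
have xS i : (i < size l)%N ->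
    x i.+1 = act (\prod_(u <- take i l) u)%g (act (nth 1%g l i) o).
  by move=> il; rewrite /x (take_nth 1%g)// -cats1 big_cat big_seq1 actM.
have -> : act (\prod_(u <- l) u)%g o = x (size l) by rewrite /x take_size.
have -> : o = x 0%N by rewrite /x take0 big_nil act1.
apply: (broken_geodesic_length hypX delta_ge0 M_ge0 (lexx _)).
- move=> i il; rewrite xS// mdist_act.
  have [/SL//|/SL] := Sl _ (mem_nth 1%g il).
  by rewrite mdist_actV invgK metric_sym.
- move=> i il; rewrite (xS i.+1)//
  [x i](_ : _ = act (\prod_(u <- take i.+1 l) u)%g (act (nth 1%g l i)^-1%g o));
  last first.
    by rewrite (take_nth 1%g) 1?ltnW// -cats1 big_cat big_seq1 actM actVK.
  rewrite gromov_product_act; apply: SM; last exact: reduced.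
    by rewrite invgK; have [] := Sl _ (mem_nth 1%g (ltnW il)); [right|left].
  exact: Sl (mem_nth 1%g il).
Qed.

(** A word of minimal length is reduced, since a cancelling pair could be
    removed. *)
Lemma minimal_word (S : set G) g : generated_subgroup S g ->
  exists l, [/\ is_word S l, (\prod_(u <- l) u)%g = g &
    forall i, (i.+1 < size l)%N -> ((nth 1 l i)^-1 != nth 1 l i.+1)%g].
Proof.
move=> /generated_subgroup_word[l0 Sl0 l0g].
pose P n := `[< exists l, [/\ is_word S l, (\prod_(u <- l) u)%g = g & size l =
  n] >].
have exP : exists n, P n by exists (size l0); apply/asboolP; exists l0.
case: (ex_minnP exP) => n /asboolP[l [Sl lg ln]] minl; exists l;
  split=> // i il.
apply/negP => /eqP cancel.
suff /minl : P (size (take i l ++ drop i.+2 l)).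
  rewrite -ln size_cat size_take size_drop (ltnW il) leqNgt -{2}(subnKC il).
  by rewrite ltn_add2r ltnS leqnSn.
apply/asboolP; exists (take i l ++ drop i.+2 l); split=> //.
  by move=> x; rewrite mem_cat => /orP[/mem_take|/mem_drop]; exact: Sl.
rewrite -lg -[in RHS](cat_take_drop i l) (drop_nth 1%g (ltnW il))
  (drop_nth 1%g il).
by rewrite !big_cat/= !big_cons -cancel mulVKg.
Qed.

(** Reduced words give the lower bound with constant $1$, since a word of length
    $m$ moves the base point by at least $m$; the upper bound holds for any
    generators. Distinct indices may carry the same group element, hence the
    hypothesis [g != h] on elements. *)
Lemma separated_quasi_isometric_embedding (delta M : R) k (s : 'I_k -> G) o :
    delta_hyperbolic X delta -> 0 <= delta -> 0 <= M ->
    (forall j, 2 * M + 3 * delta + 1 <= mdist o (act (s j) o)) ->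
    (forall i j (p q : bool), let g := if p then s i else (s i)^-1%g in
       let h := if q then s j else (s j)^-1%g in
       g != h -> gromov_product o (act g o) (act h o) <= M) ->
  quasi_isometric_embedding (generated_subgroup (range s))
    (word_metric R (range s)) (fun g => act g o).
Proof.
move=> hypX delta_ge0 M_ge0 sL sM.
pose K : R := 1 + \sum_j mdist o (act (s j) o).
have sum_ge0 : 0 <= \sum_j mdist o (act (s j) o).
  by apply: sumr_ge0 => j _; exact: mdist_ge0.
have K_ge1 : 1 <= K by rewrite lerDl.
have sK g : range s g -> mdist o (act g o) <= K.
  move=> [j _ <-]; rewrite /K (bigD1 j)//= addrCA lerDl addr_ge0//.
  by apply: sumr_ge0 => i _; exact: mdist_ge0.
exists K, 0; split=> // a b Sa Sb.
have [_ SM SV] := generated_subgroupP (range s).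
have {Sa Sb} Sg : generated_subgroup (range s) (a^-1 * b)%g by apply: SM => //;
  exact: SV.
rewrite subr0 addr0 metric_sym mdist_actV -actM metric_sym.
rewrite /word_metric /word_length.
set lengths := (X in inf X).
have lengths_lb : has_lbound lengths by exists 0 => _ [l _ <-].
have [l [Sl lg reduced]] := minimal_word Sg.
have lengths_l : lengths (size l)%:R by exists l.
apply/andP; split.
- apply: (@le_trans _ _ (inf lengths)).
    rewrite ler_piMl ?invf_le1 ?(lt_le_trans ltr01)//.
    apply: lb_le_inf; first by exists (size l)%:R.
    by move=> _ [m _ <-]; exact: ler0n.
  apply: (@le_trans _ _ (size l)%:R); first exact: ge_inf.
  rewrite -lg; apply: (word_is_broken_geodesic hypX delta_ge0 M_ge0 Sl) => //.
  + by move=> _ [j _ <-].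
  + move=> u v Su Sv.
    have signed w : range s w \/ range s w^-1%g ->
        exists j (p : bool), w = if p then s j else (s j)^-1%g.
      case=> [[j _ <-]|[j _ jw]]; first by exists j, true.
      by exists j, false; rewrite jw invgK.
    have [i [p ->]] := signed _ Su; have [j [q ->]] := signed _ Sv.
    exact: sM.
- rewrite -ler_pdivrMl ?(lt_le_trans ltr01)//.
  apply: lb_le_inf; first by exists (size l)%:R.
  move=> _ [m [Sm mg] <-].
  rewrite ler_pdivrMl ?(lt_le_trans ltr01)// -mg.
  exact: mdist_word_le Sm sK.
Qed.

End isometric_action.

(** * Orbits of loxodromic isometries *)

Section axis.
Context (R : realType) (G : groupType) (X : metricType R) (act : G -> X -> X).
Hypothesis actP : isometric_action act.
Implicit Types a g h : G.

(** Positivity of the lower limit at one point gives linear growth at every base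
    point, as two orbits of the same isometry stay at bounded distance. *)
Lemma loxodromic_growth a o : loxodromic (act a) ->
  exists c K : R, 0 < c /\ exists n0, forall n, (n0 <= n)%N ->
    c * n%:R - K <= mdist o (act (a ^+ n)%g o).
Proof.
move=> [x]; rewrite limn_einf_lim
  (cvg_lim (@ereal_hausdorff _) (@cvg_einfs_sup _ _))//.
move=> /ereal_sup_gt[_ [n0 _ <-]]; rewrite /einfs/=.
set u := fun n => _; set I := ereal_inf _ => I_gt0.
have Iu n : (n0 <= n)%N -> (I <= u n)%E.
  by move=> n0n; apply: ereal_inf_lbound; exists n.
have I_fin : I \is a fin_num.
  by rewrite ge0_fin_numE ?(ltW I_gt0)// (le_lt_trans (Iu n0 _))//= ltry.
exists (fine I), (2 * mdist o x); split; first by rewrite fine_gt0// I_gt0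
  ltey_eq I_fin.
exists n0.+1 => n n0n.
have n_gt0 : (0 < n%:R :> R) by rewrite ltr0n (leq_trans _ n0n).
have := Iu n (ltnW n0n); rewrite -[I]fineK// lee_fin ler_pdivlMr//
  (iter_act actP).
have := metric_triangle x o (act (a ^+ n)%g x).
have := metric_triangle o (act (a ^+ n)%g o) (act (a ^+ n)%g x).
rewrite (mdist_act actP) (metric_sym x o); intros; lra.
Qed.

(** If doubling [n] always added less than [C], then $l(2^k)$ would grow at most
    linearly in $k$, against the linear growth of [l]. *)
Lemma doubling_of_growth (l : nat -> R) (c K C : R) n0 :
    0 < c -> (forall n, (n0 <= n)%N -> c * n%:R - K <= l n) ->
  exists2 n, (0 < n)%N & l n + C <= l (2 * n)%N.
Proof.
move=> c_gt0 growth; apply: contrapT => small.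
have {}small n : (0 < n)%N -> l (2 * n)%N <= l n + C.
  move=> n_gt0; rewrite leNgt; apply/negP => lt.
  by apply: small; exists n => //; exact: ltW.
have l_le k : l (2 ^ k)%N <= l 1%N + k%:R * C.
  elim: k => [|k IH]; first by rewrite mul0r addr0.
  have := small (2 ^ k)%N; rewrite expn_gt0 => /(_ isT).
  rewrite expnS -natr1 mulrDl mul1r; intros; lra.
pose T := `|K| + `|l 1%N| + 2 * `|C|.
have [N TN] : exists N, T / c < N%:R.
  by exists (Num.truncn (T / c)).+1; exact: truncnS_gt.
(* Past [n0] the growth hypothesis applies, and past [N] a quadratic term $cj^2$
   exceeds $Tj$. *)
pose j := maxn N n0.
(* Along the even powers $2^{2j}=(2^j)^2\ge(j+1)^2$, which beats any linear
   function of $j$. *)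
have jpow : (j.+1 <= 2 ^ j)%N by exact: ltn_expl.
have := growth (2 ^ (2 * j))%N; rewrite (leq_trans (leq_maxr N n0))//;
  last first.
  by rewrite (leq_trans (ltnW jpow))// leq_exp2l// leq_pmull.
move=> /(_ isT) lower.
have upper := l_le (2 * j)%N.
have sq : (j.+1%:R * j.+1%:R : R) <= (2 ^ (2 * j))%:R.
  by rewrite -natrM ler_nat (mulnC 2) expnM -mulnn leq_mul.
have Tj : T < c * j.+1%:R.
  rewrite mulrC -ltr_pdivrMr// (lt_le_trans TN)// ler_nat.
  by rewrite (leq_trans (leq_maxl N n0)).
have j1 : (1 : R) <= j.+1%:R by rewrite ler1n.
have C_le : (2 * j)%:R * C <= 2 * `|C| * j.+1%:R.
  rewrite natrM -!mulrA ler_pM2l// mulrC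
    (le_trans (ler_wpM2r _ (ler_norm C)))//.
  by rewrite ler_wpM2l// ler_nat.
have K_le : K <= `|K| * j.+1%:R by rewrite (le_trans (ler_norm _))// ler_peMr.
have l_le1 : l 1%N <= `|l 1%N| * j.+1%:R by rewrite (le_trans (ler_norm _))//
  ler_peMr.
have {}Tj : T * j.+1%:R < c * j.+1%:R * j.+1%:R by rewrite ltr_pM2r.
have {}sq : c * j.+1%:R * j.+1%:R <= c * (2 ^ (2 * j))%:R by rewrite -mulrA
  ler_pM2l.
move: Tj; rewrite /T !mulrDl; intros; lra.
Qed.

(** The powers of [g] push the base point along a quasi-geodesic line: this is
    the form in which loxodromic isometries are used. *)
Definition axis (o : X) (D : R) g : Prop :=
  (forall m, m%:R <= mdist o (act (g ^+ m)%g o)) /\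
  forall m n, gromov_product o (act (g ^+ m)%g o) (act (g ^- n)%g o) <= D.

(** For $l_n=d(o,a^no)$ one has $(o\cdot a^{2n}o)_{a^no}=l_n-l_{2n}/2$. Where
    doubling increases $l_n$ by $3\delta+1$, the orbit of [a ^+ n] is therefore
    a broken geodesic. *)
Lemma loxodromic_axis (delta : R) a o : delta_hyperbolic X delta ->
    0 <= delta -> loxodromic (act a) ->
  exists2 N, (0 < N)%N & exists D, axis o D (a ^+ N)%g.
Proof.
move=> hypX delta_ge0 /(loxodromic_growth o)[c [K [c_gt0 [n0 growth]]]].
have [N N_gt0 dbl] :=
  doubling_of_growth (l := fun n => mdist o (act (a ^+ n)%g o)) (3 * delta + 1)
    c_gt0 growth.
exists N => //; set g := (a ^+ N)%g.
rewrite mulnC expgnA -/g in dbl.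
pose M := gromov_product (act g o) o (act (g ^+ 2)%g o).
have M_ge0 : 0 <= M by exact: gromov_product_ge0.
have stepE k : mdist (act (g ^+ k)%g o) (act (g ^+ k.+1)%g o) = mdist o
  (act g o).
  by rewrite expgSr (actM actP) (mdist_act actP).
have turnE k : gromov_product (act (g ^+ k.+1)%g o) (act (g ^+ k)%g o)
    (act (g ^+ k.+2)%g o) = M.
  rewrite /M -[RHS](gromov_product_act actP (g ^+ k)%g) -!(actM actP).
  by rewrite -expgSr -expgnDr addn2.
have ML : 2 * M + 3 * delta + 1 <= mdist o (act g o).
  rewrite /M /gromov_product (metric_sym _ o) expg2 (actM actP)
    (mdist_act actP).
  by rewrite expg2 (actM actP) in dbl; lra.
pose x k := act (g ^+ k)%g o.
have x0 : o = x 0%N by rewrite /x expg0 (act1 actP).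
exists (M + 2 * delta); split=> [m|m n].
  rewrite {1}x0; apply: (broken_geodesic_length hypX delta_ge0 M_ge0 ML).
    by move=> i _; rewrite stepE.
  by move=> i _; rewrite turnE.
have [->|m_gt0] := posnP m.
  rewrite expg0 (act1 actP) (le_trans (gromov_product_le_mdist _ _ _))//.
  by rewrite mdistxx addr_ge0// mulr_ge0.
have [->|n_gt0] := posnP n.
  rewrite expg0 invg1 (act1 actP) gromov_productC.
  rewrite (le_trans (gromov_product_le_mdist _ _ _))//.
  by rewrite mdistxx addr_ge0// mulr_ge0.
rewrite -(gromov_product_act actP (g ^+ n)%g) (actVK actP) -(actM actP)
  -expgnDr.
rewrite gromov_productC [X in gromov_product _ X]x0.
apply: (broken_geodesic_inner hypX delta_ge0 ML (x := x)).
- by move=> i _; rewrite /x stepE.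
- by move=> i _; rewrite /x turnE.
- by rewrite n_gt0 -{1}(addn0 n) ltn_add2l.
Qed.

Lemma axisV o (D : R) g : axis o D g -> axis o D (g^-1)%g.
Proof.
move=> [len gp]; split=> [m|m n].
  by rewrite (mdist_actV actP) expVgn invgK metric_sym.
by rewrite !expVgn invgK gromov_productC.
Qed.

Lemma axis_gromov_product o (D : R) g m n : axis o D g -> (m <= n)%N ->
  m%:R - D <= gromov_product o (act (g ^+ m)%g o) (act (g ^+ n)%g o).
Proof.
move=> [len gp] mn; rewrite gromov_product_switch lerB//.
rewrite -(gromov_product_act actP (g ^- m)%g) !(actK actP) -(actM actP).
by rewrite -(subnKC mn) expgnDr mulKg gromov_productC.
Qed.

(** In this form the base point is fixed once and for all. *)
Lemma gromov_equivP o (u v : nat -> X) : gromov_equiv u v <->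
  forall M : R, exists N, forall m n, (N <= m)%N -> (N <= n)%N ->
    M <= gromov_product o (u m) (v n).
Proof.
split=> [uv M|uv w M].
  have [[A B] /= [[N1 _ AN] [N2 _ BN]] AB] := uv o M.
  exists (maxn N1 N2) => m n; rewrite !geq_max => /andP[Nm _] /andP[_ Nn].
  by apply: (AB (m, n)); split; [exact: AN|exact: BN].
have [N uvN] := uv (M + mdist o w).
exists ([set m | (N <= m)%N], [set m | (N <= m)%N]) => /=.
  by split; exists N.
move=> [m n] /= [Nm Nn]; have := uvN _ _ Nm Nn.
by have := gromov_product_base o w (u m) (v n); intros; lra.
Qed.

Lemma axis_gromov_sequence o (D : R) g : axis o D g ->
  gromov_sequence (fun k => act (g ^+ k)%g o).
Proof.
move=> ax; apply/(gromov_equivP o) => M.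
have [N MN] : exists N : nat, M + D <= N%:R.
  by exists (Num.truncn (M + D)).+1; exact/ltW/truncnS_gt.
exists N => m n Nm Nn; wlog mn : m n Nm Nn / (m <= n)%N.
  by move=> H; case/orP: (leq_total m n) => [|?];
    [exact: H|rewrite gromov_productC; exact: H].
have := axis_gromov_product ax mn.
have : N%:R <= m%:R :> R by rewrite ler_nat.
intros; lra.
Qed.

Lemma gromov_equiv_sym (u v : nat -> X) : gromov_equiv u v -> gromov_equiv v u.
Proof.
move=> uv; pose w := u 0%N; apply/(gromov_equivP w) => M.
have [N uvN] := (gromov_equivP w u v).1 uv M.
by exists N => m n Nm Nn; rewrite gromov_productC; exact: uvN.
Qed.

Lemma gromov_equiv_trans (delta : R) (u v t : nat -> X) :
    delta_hyperbolic X delta ->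
  gromov_equiv u v -> gromov_equiv v t -> gromov_equiv u t.
Proof.
move=> hypX uv vt; pose w := u 0%N; apply/(gromov_equivP w) => M.
have [N1 uvN] := (gromov_equivP w u v).1 uv (M + delta).
have [N2 vtN] := (gromov_equivP w v t).1 vt (M + delta).
exists (maxn N1 N2) => m n; rewrite !geq_max => /andP[N1m N2m] /andP[N1n N2n].
have := uvN m (maxn N1 N2) N1m (leq_maxl _ _).
have := vtN (maxn N1 N2) n (leq_maxr _ _) N2n.
by have [] := four_point hypX w (u m) (t n) (v (maxn N1 N2)); intros; lra.
Qed.

End axis.

(** * Fixed points at infinity, Schottky pairs and words *)

Section schottky.
Context (R : realType) (G : groupType) (X : metricType R) (act : G -> X -> X).
Hypothesis actP : isometric_action act.
Implicit Types a g h : G.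

Lemma gromov_equiv_act a (u v : nat -> X) :
  gromov_equiv u v -> gromov_equiv (act a \o u) (act a \o v).
Proof.
move=> uv; pose o := u 0%N; apply/(gromov_equivP (act a o)) => M.
have [N uvN] := (gromov_equivP o u v).1 uv M.
by exists N => m n Nm Nn; rewrite (gromov_product_act actP); exact: uvN.
Qed.

Lemma gromov_equiv_bounded (C : R) (u v v' : nat -> X) :
  (forall k, mdist (v k) (v' k) <= C) -> gromov_equiv u v -> gromov_equiv u v'.
Proof.
move=> vv' uv; pose o := u 0%N; apply/(gromov_equivP o) => M.
have [N uvN] := (gromov_equivP o u v).1 uv (M + C).
exists N => m n Nm Nn; have := uvN m n Nm Nn; have := vv' n.
have := gromov_product_move o (u m) (v n) (v' n); intros; lra.
Qed.

(** Applying [a], which commutes with [g], moves each point $g^ko$ by the same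
    distance $d(o,ao)$, and bounded perturbations do not change the point at
    infinity. *)
Lemma axis_boundary_fixed_point (delta D : R) a g o :
    delta_hyperbolic X delta -> commute a g -> axis act o D g ->
  boundary_fixed_points (act a)
    [set v | gromov_sequence v /\ gromov_equiv (fun k => act (g ^+ k)%g o) v].
Proof.
move=> hypX ag ax; have useq := axis_gromov_sequence actP ax.
set u := fun k => _ in useq *.
split; first by exists u.
have invariant b (v : nat -> X) : commute b g ->
    gromov_sequence v /\ gromov_equiv u v ->
    gromov_sequence (act b \o v) /\ gromov_equiv u (act b \o v).
  move=> bg [vseq uv]; split; first exact: gromov_equiv_act.
  apply: (gromov_equiv_trans hypX) (gromov_equiv_act b uv).
  apply: (gromov_equiv_bounded (C := mdist o (act b o))) useq => k.
  by rewrite /u/= -(actM actP) (commuteX k bg) (actM actP) (mdist_act actP).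
apply/seteqP; split=> [_ [v vu <-]|v vu]; first exact: invariant.
exists (act a^-1%g \o v).
  by apply: invariant => //; apply: commute_sym; apply/commuteV/commute_sym.
by apply/funext => k /=; rewrite (actVK actP).
Qed.

(** Two Gromov sequences either define the same point at infinity or have
    bounded mutual Gromov products: one pair of late terms with a large product
    forces, by two four-point inequalities, large products for all later
    pairs. *)
Lemma gromov_product_bounded (delta : R) (u v : nat -> X) o :
    delta_hyperbolic X delta -> 0 <= delta ->
    gromov_sequence u -> gromov_sequence v ->
    ~ gromov_equiv u v ->
  exists (E : R) N, forall m n, (N <= m)%N -> (N <= n)%N ->
    gromov_product o (u m) (v n) <= E.
Proof.
move=> hypX delta_ge0 useq vseq; apply: contra_notP => unbounded.
apply/(gromov_equivP o) => M.
have [N1 uN] := (gromov_equivP o u u).1 useq (M + 2 * delta).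
have [N2 vN] := (gromov_equivP o v v).1 vseq (M + 2 * delta).
exists (maxn N1 N2) => m n; rewrite !geq_max => /andP[N1m N2m] /andP[N1n N2n].
apply: contrapT => /negP; rewrite -ltNge => small.
(* One late pair with product below [M] bounds the products of all late pairs by
   [M + 2 * delta]. *)
apply: unbounded; exists (M + 2 * delta), (maxn N1 N2) => m' n'.
rewrite !geq_max => /andP[N1m' N2m'] /andP[N1n' N2n'].
rewrite leNgt; apply/negP => large.
have := uN m m' N1m N1m'; have := vN n' n N2n' N2n.
have [] := four_point hypX o (u m) (v n) (u m'); first by intros; lra.
by have [] := four_point hypX o (u m') (v n) (v n'); intros; lra.
Qed.

(** If the Gromov products were unbounded, the two orbits would define the same
    point at infinity, fixed by both [a] and [b]. *)
Lemma axes_separated (delta D D' : R) a (b : G) g h o :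
    delta_hyperbolic X delta -> 0 <= delta ->
    boundary_fixed_points (act a) `&` boundary_fixed_points (act b) = set0 ->
    commute a g -> commute b h -> axis act o D g -> axis act o D' h ->
  exists (E : R) N, forall m n, (N <= m)%N -> (N <= n)%N ->
    gromov_product o (act (g ^+ m)%g o) (act (h ^+ n)%g o) <= E.
Proof.
move=> hypX delta_ge0 disj ag bh axg axh.
apply: (gromov_product_bounded o hypX delta_ge0) (axis_gromov_sequence actP axg)
  (axis_gromov_sequence actP axh) _ => gh.
have hg := gromov_equiv_sym gh.
have fixg := axis_boundary_fixed_point hypX ag axg.
have := axis_boundary_fixed_point hypX bh axh.
rewrite (_ : [set v | _] = [set v | gromov_sequence v /\
    gromov_equiv (fun k => act (g ^+ k)%g o) v]); last first.
  by apply/seteqP; split=> v [vseq ev]; split=> //;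
    [exact: (gromov_equiv_trans hypX gh ev)|exact:
      (gromov_equiv_trans hypX hg ev)].
move=> fixh; suff : set0 [set v | gromov_sequence v /\
    gromov_equiv (fun k => act (g ^+ k)%g o) v] by [].
by rewrite -disj.
Qed.

Definition letter g h (b : bool) : G := if b then g else h.

Definition signed (s : bool) g : G := if s then g else (g^-1)%g.

(** The four points $g^{\pm1}o,h^{\pm1}o$ are far from [o] and lie in pairwise
    different directions. The bound [E] on the products is separate from [L]
    because [L] is taken large after [E] has been found. *)
Definition schottky_pair (o : X) (E L : R) g h : Prop :=
  (forall b, L <= mdist o (act (letter g h b) o)) /\
  forall b c s t, (b, s) != (c, t) ->
    gromov_product o (act (signed s (letter g h b)) o)
      (act (signed t (letter g h c)) o) <= E.

Lemma axis_signed o (D : R) g s : axis act o D g -> axis act o D (signed s g).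
Proof. by case: s => //; exact: axisV. Qed.

(** [E] depends only on the two axes, while [L] becomes as large as desired
    along their powers; the exponents [m] and [n] are independent, which later
    allows them to be matched. *)
Lemma loxodromic_schottky_pair (delta : R) a (b : G) o :
    delta_hyperbolic X delta -> 0 <= delta ->
    loxodromic (act a) -> loxodromic (act b) ->
    boundary_fixed_points (act a) `&` boundary_fixed_points (act b) = set0 ->
  exists p q (E : R), [/\ (0 < p)%N, (0 < q)%N & forall L : R,
    exists N, forall m n, (N <= m)%N -> (N <= n)%N ->
      schottky_pair o E L (a ^+ (p * m))%g (b ^+ (q * n))%g].
Proof.
move=> hypX delta_ge0 loxa loxb disj.
have [p p_gt0 [D axg]] := loxodromic_axis actP o hypX delta_ge0 loxa.
have [q q_gt0 [D' axh]] := loxodromic_axis actP o hypX delta_ge0 loxb.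
set g := (a ^+ p)%g in axg; set h := (b ^+ q)%g in axh.
have ag s : commute a (signed s g).
  by case: s => /=; [|apply: commuteV]; apply: commuteX; apply: commute_refl.
have bh s : commute b (signed s h).
  by case: s => /=; [|apply: commuteV]; apply: commuteX; apply: commute_refl.
have sep s t := axes_separated hypX delta_ge0 disj (ag s) (bh t)
  (axis_signed s axg) (axis_signed t axh).
have [E1 [N1 gh]] : exists (E : R) N, forall s t m n, (N <= m)%N -> (N <= n)%N
  ->
    gromov_product o (act (signed s g ^+ m)%g o) (act (signed t h ^+ n)%g o) <=
      E.
  have [f Hf] := choice (fun st => sep st.1 st.2).
  have [N HN] := choice Hf.
  exists (\big[Num.max/0]_st f st), (\max_st N st)%N => s t m n Nm Nn.
  rewrite (le_trans (HN (s, t) m n _ _))//.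
  - by rewrite (leq_trans (leq_bigmax (s, t)) Nm).
  - by rewrite (leq_trans (leq_bigmax (s, t)) Nn).
  - exact: le_bigmax.
have D_ge0 : 0 <= D by rewrite (le_trans _ (axg.2 0%N 0%N))//
  gromov_product_ge0.
have D'_ge0 : 0 <= D' by rewrite (le_trans _ (axh.2 0%N 0%N))//
  gromov_product_ge0.
exists p, q, (D + D' + `|E1|); split=> // L.
have E1_le := ler_norm E1; have E1_ge0 := normr_ge0 E1.
exists (maxn N1 (Num.truncn L).+1) => m n.
rewrite !geq_max !expgnA => /andP[N1m Lm] /andP[N1n Ln].
have far (k : nat) f D0 : axis act o D0 f -> (Num.truncn L < k)%N ->
    L <= mdist o (act (f ^+ k)%g o).
  move=> ax Lk; rewrite (le_trans _ (ax.1 k))// ltW//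
    (lt_le_trans (truncnS_gt _))//.
  by rewrite ler_nat.
have signedX s f k : signed s (f ^+ k)%g = (signed s f ^+ k)%g.
  by case: s => //=; rewrite expVgn.
have same f D0 s t k : axis act o D0 f -> s != t ->
    gromov_product o (act (signed s (f ^+ k)%g) o)
      (act (signed t (f ^+ k)%g) o) <= D0.
  by case: s t => [] [] // ax _; [|rewrite gromov_productC]; apply: ax.2.
split=> [[]|[] [] s t]; first exact: far axg Lm.
- exact: far axh Ln.
- by rewrite xpair_eqE eqxx/= => st; apply: le_trans (same _ _ _ _ m axg st) _;
  lra.
- by move=> _; have := gh s t m n N1m N1n; rewrite -!signedX => /le_trans;
  apply; lra.
- move=> _; rewrite gromov_productC.
  by have := gh t s m n N1m N1n; rewrite -!signedX => /le_trans; apply; lra.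
- by rewrite xpair_eqE eqxx/= => st; apply: le_trans (same _ _ _ _ n axh st) _;
  lra.
Qed.

Definition word g h (W : seq bool) : G := (\prod_(b <- W) letter g h b)%g.

Lemma word_cons g h b W : word g h (b :: W) = (letter g h b * word g h W)%g.
Proof. exact: big_cons. Qed.

(** A point cannot lie in the directions of both $g^{-1}o$ and $h^{-1}o$, so it
    is not repelled by one of the two letters. *)
Lemma schottky_first_letter (delta E L : R) o g h y :
    delta_hyperbolic X delta -> schottky_pair o E L g h ->
  exists c, gromov_product o (act (letter g h c)^-1%g o) y <= E + delta.
Proof.
move=> hypX [_ sep].
have := sep true false false false isT; rewrite /signed => gp.
have [] := four_point hypX o (act (letter g h true)^-1%g o)
  (act (letter g h false)^-1%g o) y => ?; [exists true|exists false];
    first by lra.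
by rewrite gromov_productC; lra.
Qed.

(** A letter sends every point outside its repelling direction deep into its
    attracting direction, since $(lo\cdot ly)_o=|l|-(l^{-1}o\cdot y)_o$. *)
Lemma schottky_attract (delta E L : R) o g h c y :
    schottky_pair o E L g h ->
    gromov_product o (act (letter g h c)^-1%g o) y <= E + delta ->
  L - E - delta <= gromov_product o (act (letter g h c) o)
    (act (letter g h c) y).
Proof.
move=> [far _]; set l := letter g h c => gp; have := far c; rewrite -/l.
rewrite -(gromov_product_act actP l^-1%g) !(actK actP) gromov_product_switch.
by rewrite (mdist_actV actP) ; intros; lra.
Qed.

(** Ping-pong: once the rightmost letter, applied first, has sent [y] into an
    attracting direction, every further letter applies to a point outside its
    repelling direction. The image lies in the attracting direction of the
    leftmost letter of the word. *)
Lemma schottky_word_lands (delta E L : R) o g h c y W :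
    delta_hyperbolic X delta -> 0 <= delta -> schottky_pair o E L g h ->
    2 * E + 3 * delta + 1 <= L ->
    gromov_product o (act (letter g h c)^-1%g o) y <= E + delta ->
  L - E - delta <= gromov_product o (act (letter g h (head c W)) o)
    (act (word g h (rcons W c)) y).
Proof.
move=> hypX delta_ge0 sch EL yc; elim: W => [|b W IH].
  by rewrite /word/= big_seq1; exact: (schottky_attract sch).
rewrite [rcons _ _]/= word_cons (actM actP).
apply: (schottky_attract sch).
set z := act (word _ _ _) y in IH *; rewrite [head _ _]/=.
have := sch.2 (head c W) b true false; rewrite xpair_eqE andbF => /(_ isT).
by have [] := four_point hypX o (act (letter g h (head c W)) o)
  (act (letter g h b)^-1%g o) z;
  rewrite /signed ?(gromov_productC o z); intros; lra.
Qed.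

(** At the first letter in which they differ the two words land in different
    attracting directions. A common prefix of length [j] does not change
    distances and changes Gromov products at [o] by at most [j * m]. *)
Lemma schottky_words_separated (delta E L m : R) o g h c y W W' :
    delta_hyperbolic X delta -> 0 <= delta -> schottky_pair o E L g h ->
    2 * E + 3 * delta + 1 <= L ->
    (forall b, mdist o (act (letter g h b) o) <= m) ->
    gromov_product o (act (letter g h c)^-1%g o) y <= E + delta ->
    size W = size W' -> W != W' ->
  let z := act (word g h (rcons W c)) y in
  let z' := act (word g h (rcons W' c)) y in
  gromov_product o z z' <= E + 2 * delta + (size W)%:R * m /\
  2 * L - 4 * E - 6 * delta <= mdist z z'.
Proof.
move=> hypX delta_ge0 sch EL lm yc.
have m_ge0 : 0 <= m by rewrite (le_trans _ (lm true))// mdist_ge0.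
elim: W W' => [|b W IH] [|b' W']// [sW] WW' z z'.
have [bb'|bb'] := eqVneq b b'.
  have {}WW' : W != W' by move: WW'; rewrite bb' eqseq_cons eqxx.
  move: (IH W' sW WW'); rewrite /z /z' -bb' !rcons_cons !word_cons !(actM actP).
  rewrite (mdist_act actP) => /= -[gp ->]; split=> //.
  apply: le_trans (gromov_product_base _ (act (letter g h b) o) _ _) _.
  rewrite (gromov_product_act actP).
  have -> : (size W).+1%:R * m = (size W)%:R * m + m by rewrite -natr1 mulrDl
    mul1r.
  by rewrite addrA; exact: lerD gp (lm b).
have l : L - E - delta <= gromov_product o (act (letter g h b) o) z.
  exact: (schottky_word_lands (b :: W) hypX delta_ge0 sch EL yc).
have l' : L - E - delta <= gromov_product o (act (letter g h b') o) z'.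
  exact: (schottky_word_lands (b' :: W') hypX delta_ge0 sch EL yc).
have := sch.2 b b' true true; rewrite xpair_eqE andbT => /(_ bb').
rewrite /signed => sep.
have gp : gromov_product o z z' <= E + 2 * delta.
  have [] := four_point hypX o (act (letter g h b) o) (act (letter g h b') o) z.
    by intros; lra.
  have [] := four_point hypX o z (act (letter g h b') o) z'; first by intros;
    lra.
  by rewrite (gromov_productC o z'); intros; lra.
split.
  by rewrite (le_trans gp)// lerDl mulr_ge0.
rewrite (mdist_gromov_product o); rewrite gromov_productC in l;
  rewrite gromov_productC in l'.
have := gromov_product_le_mdist o z (act (letter g h b) o).
have := gromov_product_le_mdist o z' (act (letter g h b') o).
intros; lra.
Qed.

End schottky.

(** * Disintegration over a countable group *)

Section discrete_disintegration.
Local Open Scope ereal_scope.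
Context (R : realType) (G : groupType).
Hypothesis G_countable : countable [set: G].
Let Gamma := discrete_group G.

Context (d : measure_display) (Omega : measurableType d)
  (P : probability Omega R).

Let fiber_partition (U : Omega -> Gamma) (F : Gamma -> set Omega)
  (e : G -> nat) :
  [set omega | F (U omega) omega] =
  \bigcup_n \bigcup_(u in [set u | e u = n]) (U @^-1` [set u] `&` F u).
Proof.
apply/seteqP; split=> [omega Fo|omega [n _ [u /= _ [<-]]]]//.
by exists (e (U omega)) => //; exists (U omega).
Qed.

Let fiberE (T : Type) (e : G -> nat) (F : Gamma -> set T) n : injective e ->
  \bigcup_(u in [set u | e u = n]) F u = set0 \/
  exists2 u : Gamma, [set u | e u = n] = [set u] &
    \bigcup_(u in [set u | e u = n]) F u = F u.
Proof.
move=> e_inj; have [[u un]|no] := pselect (exists u, e u = n); last first.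
  by left; apply/seteqP; split=> // t [u /= un]; case: no; exists u.
have set1E : [set u | e u = n] = [set u].
  by apply/seteqP; split=> [v /= vn|v ->//]; apply: e_inj; rewrite vn.
by right; exists u => //; rewrite set1E bigcup_set1.
Qed.

Lemma countable_injective : exists e : G -> nat, injective e.
Proof.
by have /countable_injP[e e_inj] := G_countable; exists e => u v; apply: e_inj;
  rewrite inE.
Qed.

Lemma measurable_fibers (U : {mfun Omega >-> Gamma}) (F : Gamma -> set Omega) :
  (forall u, measurable (F u)) -> measurable [set omega | F (U omega) omega].
Proof.
move=> mF; have [e e_inj] := countable_injective.
rewrite (fiber_partition _ _ e); apply: bigcup_measurable => n _.
have mUF u : measurable (U @^-1` [set u] `&` F u).
  by apply: measurableI => //; rewrite -[X in measurable X]setTI;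
    exact: measurable_funP.
by have [->//|[u _ ->//]] := fiberE (fun u => U @^-1` [set u] `&` F u) n e_inj.
Qed.

(** Conditioning on a variable [U] with countably many values: [phi u] is the
    conditional probability of [F u] given [U = u]. *)
Lemma disintegration (U : {mfun Omega >-> Gamma}) (F : Gamma -> set Omega)
    (phi : Gamma -> \bar R) :
    (forall u, measurable (F u)) -> (forall u, 0 <= phi u) ->
    (forall u, P (U @^-1` [set u] `&` F u) = P (U @^-1` [set u]) * phi u) ->
  P [set omega | F (U omega) omega] = \int[distribution P U]_u phi u.
Proof.
move=> mF phi_ge0 PUF; have [e e_inj] := countable_injective.
have mUF u : measurable (U @^-1` [set u] `&` F u).
  by apply: measurableI => //; rewrite -[X in measurable X]setTI;
    exact: measurable_funP.
have fib n := fiberE (fun u => U @^-1` [set u] `&` F u) n e_inj.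
rewrite (fiber_partition _ _ e) measure_semi_bigcup; first last.
- by apply: bigcup_measurable => n _; have [->//|[u _ ->//]] := fib n.
- apply/trivIsetP => i j _ _ ij; apply/seteqP; split=> // omega.
  by move=> [[u /= ui [Uu _]] [v /= vj [Uv _]]]; move: ij;
    rewrite -ui -vj -Uu -Uv eqxx.
- by move=> n; have [->//|[u _ ->//]] := fib n.
have -> : [set: Gamma] = \bigcup_n [set u | e u = n].
  by apply/seteqP; split=> // u _; exists (e u).
rewrite ge0_integral_bigcup//; last first.
  by apply/trivIsetP => i j _ _ ij; apply/seteqP; split=> // u [/= ui uj];
    rewrite -ui -uj eqxx in ij.
apply: eq_eseriesr => n _.
have [[u un]|no] := pselect (exists u, e u = n).
  have set1E : [set u | e u = n] = [set u].
    by apply/seteqP; split=> [v /= vn|v ->//]; apply: e_inj; rewrite vn.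
  rewrite set1E bigcup_set1.
  rewrite (eq_integral (cst (phi u))); last by move=> v /set_mem ->.
  by rewrite integral_cst// [RHS]muleC; exact: PUF.
have -> : [set u | e u = n] = set0.
  by apply/seteqP; split=> // u /= un; case: no; exists u.
by rewrite bigcup_set0 measure0 integral_set0.
Qed.

End discrete_disintegration.

(** * The law of a random walk and the independence of its blocks *)

Section walk_law.
Local Open Scope ereal_scope.
Context (R : realType) (G : groupType).
Hypothesis G_countable : countable [set: G].
Let Gamma := discrete_group G.
Context (mu : probability Gamma R).

(** The [n]-th convolution power of [mu], the last increment being split off. It
    is given as a set function because it only serves to name the common law of
    all blocks of [n] increments. *)
Fixpoint walk_law n (B : set Gamma) : \bar R :=
  if n is m.+1 then \int[mu]_u walk_law m [set v : Gamma | B (v * u)%g]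
  else \d_(1%g : Gamma) B.

Lemma walk_law_ge0 n B : 0 <= walk_law n B.
Proof. by elim: n B => //= n IH B; apply: integral_ge0 => u _; exact: IH. Qed.

Lemma walk_law_le n A B : A `<=` B -> walk_law n A <= walk_law n B.
Proof.
elim: n A B => /= [|n IH] A B AB; first by rewrite le_measure ?inE.
apply: ge0_le_integral => // u _; try exact: walk_law_ge0.
by apply: IH => v; exact: AB.
Qed.

Context (d : measure_display) (Omega : measurableType d)
  (P : probability Omega R) (g : nat -> {RV P >-> Gamma}).
Hypothesis g_indep : mutually_independent P
  (fun i => g_sigma_algebra_preimage (g i)).
Hypothesis g_law : forall i, distribution P (g i) =1 mu.

Definition block m n (omega : Omega) : Gamma :=
  (\prod_(m <= i < m + n) g i omega)%g.

Lemma block0 m omega : block m 0 omega = 1%g.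
Proof. by rewrite /block addn0 big_geq. Qed.

Lemma blockSr m n omega : block m n.+1 omega =
  (block m n omega * g (m + n) omega)%g.
Proof. by rewrite /block addnS big_nat_recr// leq_addr. Qed.

Lemma block_cat m n p omega :
  block m (n + p) omega = (block m n omega * block (m + n) p omega)%g.
Proof. by rewrite /block addnA -big_cat_nat//= leq_addr. Qed.

Lemma measurable_block_preimage m n (B : set Gamma) : measurable
  [set omega | B (block m n omega)].
Proof.
elim: n B => [|n IH] B.
  rewrite (_ : [set _ | _] = [set omega | B 1%g]); last first.
    by apply/seteqP; split=> omega /=; rewrite block0.
  have [B1|B1] := pselect (B 1%g).
    by rewrite (_ : [set _ | _] = setT)//; apply/seteqP; split.
  by rewrite (_ : [set _ | _] = set0)//; apply/seteqP; split.
rewrite (_ : [set _ | _] = [set omega |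
    [set omega' | [set v : Gamma | B (v * g (m + n) omega)%g]
      (block m n omega')] omega]); last first.
  by apply/seteqP; split=> omega /=; rewrite blockSr.
exact: (measurable_fibers G_countable (g (m + n))
  (F := fun u => [set omega' | [set v : Gamma | B (v * u)%g]
    (block m n omega')])).
Qed.

(** An event [E] independent of all increments from time [m] on remains
    independent of the increments after time [m + n] when intersected with an
    event on the block between [m] and [m + n]. By induction on [n],
    conditioning on the last increment of the block, the value of which becomes
    one more of the events on single increments. The family [A] is what makes
    this induction possible. *)
Lemma block_law m E : measurable E ->
    (forall (J : {fset nat}) (A : nat -> set Omega),
      (forall i, i \in J -> (m <= i)%N /\ g_sigma_algebra_preimage (g i) (A i))
        ->
      P (E `&` \bigcap_(i in [set` J]) A i) = P E * \prod_(i <- J) P (A i)) ->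
  forall n B (J : {fset nat}) (A : nat -> set Omega),
    (forall i, i \in J -> (m + n <= i)%N /\ g_sigma_algebra_preimage (g i)
      (A i)) ->
    P (E `&` [set omega | B (block m n omega)] `&` \bigcap_(i in [set` J]) A i)
      =
    P E * walk_law n B * \prod_(i <- J) P (A i).
Proof.
move=> mE indE; elim=> [|n IH] B J A JA.
  rewrite addn0 in JA; rewrite /= diracE.
  have [B1|B1] := pselect (B 1%g).
    rewrite mem_set// mule1 (_ : [set _ | _] = setT) ?setIT; first exact: indE.
    by apply/seteqP; split=> omega //= _; rewrite block0.
  rewrite memNset// mule0 mul0e (_ : [set _ | _] = set0) ?setI0 ?set0I
    ?measure0//.
  by apply/seteqP; split=> omega //=; rewrite block0.
have mA i : i \in J -> measurable (A i).
  by move=> /JA[_ [C mC <-]]; exact: measurable_funP.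
pose F u := E `&` [set omega | [set v : Gamma | B (v * u)%g] (block m n omega)]
  `&` \bigcap_(i in [set` J]) A i.
have mF u : measurable (F u).
  apply: measurableI; first by apply: measurableI => //;
    exact: measurable_block_preimage.
  by apply: fin_bigcap_measurable => // i; exact: mA.
rewrite (_ : _ `&` _ `&` _ = [set omega | F (g (m + n) omega) omega]);
  last first.
  by apply/seteqP; split=> omega /=; rewrite blockSr.
have PJ_ge0 : 0 <= \prod_(i <- J) P (A i) by apply: prode_ge0 => i _;
  exact: measure_ge0.
rewrite (disintegration G_countable
    (phi := fun u => P E * \prod_(i <- J) P (A i) * walk_law n
      [set v | B (v * u)%g]))//.
- rewrite ge0_integralZl//; last 2 first.
    by move=> u _; exact: walk_law_ge0.
    by rewrite mule_ge0// measure_ge0.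
  rewrite muleAC /=; congr (_ * _ * _).
  by apply: eq_measure_integral => D _ _; exact: g_law.
- by move=> u; rewrite !mule_ge0// ?measure_ge0//; exact: walk_law_ge0.
move=> u.
have mnJ : (m + n)%N \notin J.
  by apply/negP => /JA[]; rewrite addnS ltnn.
(* The value of the last increment is recorded as an additional event. *)
pose A' i := if i == (m + n)%N then g (m + n) @^-1` [set u] else A i.
have A'J i : i \in J -> A' i = A i.
  by rewrite /A'; case: eqP => // ->; rewrite (negbTE mnJ).
have := IH [set v | B (v * u)%g] ((m + n)%N |` J)%fset A' _.
rewrite big_fsetU1//= (eq_big_seq (fun i => P (A i))); last by move=> i iJ;
  rewrite A'J.
rewrite set_fsetU1 bigcap_setU1 (eq_bigcapr (G := A)); last by move=> i;
  exact: A'J.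
rewrite /A' eqxx => PI.
rewrite setICA PI; last first.
  move=> i; rewrite !inE => /orP[/eqP ->|iJ].
    by rewrite eqxx; split=> //; exists [set u] => //; rewrite setTI.
  have [] := JA i iJ; rewrite addnS => mni gA; split; first exact: ltnW.
  by rewrite gtn_eqF.
by rewrite muleCA [X in _ * X]muleAC.
Qed.

Lemma block_lawT m n B (J : {fset nat}) (A : nat -> set Omega) :
    (forall i, i \in J -> (m + n <= i)%N /\ g_sigma_algebra_preimage (g i)
      (A i)) ->
    P ([set omega | B (block m n omega)] `&` \bigcap_(i in [set` J]) A i) =
    walk_law n B * \prod_(i <- J) P (A i).
Proof.
move=> JA; have PT : P [set: Omega] = 1 by exact: probability_setT.
rewrite -[X in X `&` _]setTI (_ : walk_law n B = P [set: Omega] * walk_law n B);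
  last by rewrite PT mul1e.
apply: block_law => // {}J {}A {}JA.
by rewrite setTI PT mul1e; apply: g_indep => i /JA[].
Qed.

Lemma walk_lawE m n B : P [set omega | B (block m n omega)] = walk_law n B.
Proof.
have := @block_lawT m n B fset0 (fun=> setT).
by rewrite set_fset0 bigcap_set0 setIT big_seq_fset0 mule1; apply=> i.
Qed.

Lemma block_pair_law m n A B :
  P ([set omega | A (block 0 m omega)] `&` [set omega | B (block m n omega)]) =
  walk_law m A * walk_law n B.
Proof.
have := @block_law m _ (measurable_block_preimage 0 m A) _ n B fset0
  (fun=> setT).
rewrite set_fset0 bigcap_set0 setIT big_seq_fset0 mule1 walk_lawE;
  apply=> // J F JF.
by rewrite block_lawT ?walk_lawE.
Qed.

Lemma walk_law1 B : walk_law 1 B = mu B.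
Proof.
rewrite -(walk_lawE 0 1) -(g_law 0); congr (P _).
by apply/seteqP; split=> omega /=; rewrite /block add0n big_nat1.
Qed.

End walk_law.

(** * Probabilities on a discrete group *)

Section probability_on_discrete_group.
Context (R : realType) (G : groupType).
Implicit Types nu : probability (discrete_group G) R.

(** The pigeonhole principle for probabilities. *)
Lemma small_among_disjoint nu (I : finType) (A : I -> set (discrete_group G)) :
    (0 < #|I|)%N -> (forall i j, i != j -> A i `&` A j = set0) ->
  exists i, (nu (A i) <= (#|I|%:R^-1)%:E)%E.
Proof.
move=> I_gt0 disj; apply: contrapT => big.
have {}big i : (#|I|%:R^-1%:E < nu (A i))%E.
  by rewrite ltNge; apply/negP => le; apply: big; exists i.
have : (nu (\big[setU/set0]_(k < #|I|) A (enum_val k)) <= 1)%E.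
  exact: probability_le1.
rewrite (measure_bigsetU_ord _ xpredT (F := fun k => A (enum_val k)))//;
  last first.
  apply/trivIsetP => k l _ _ kl; apply: disj.
  by apply: contra_neq kl; exact: enum_val_inj.
rewrite -(big_enum_val (fun i => nu (A i)))/= leNgt => /negP; apply.
have -> : (1 = \sum_(i : I) (#|I|%:R^-1)%:E :> \bar R)%E.
  by rewrite sumEFin sumr_const -[_^-1 *+ _]mulr_natr mulVf// pnatr_eq0 -lt0n.
have [i0 _] := card_gt0P I_gt0.
rewrite [X in (X < _)%E](bigD1 i0)//= [X in (_ < X)%E](bigD1 i0)//=.
apply: lte_leD; [|exact: big|].
  by rewrite sumEFin.
by apply: lee_sum => i _; exact/ltW/big.
Qed.

(** The integrand is at most [c] on [S], drops to [c'] at the atom [u0], and is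
    bounded by [1] elsewhere; hence the gain is $(c-c')\kappa$ and the loss at
    most [e]. *)
Lemma integral_le_contraction nu (f : discrete_group G -> \bar R)
    (S : set (discrete_group G)) u0 (c c' e kappa : R) :
    (forall u, 0 <= f u <= 1)%E -> (forall u, S u -> f u <= c%:E)%E ->
    (f u0 <= c'%:E)%E -> 0 <= c' <= c -> (nu (~` S) <= e%:E)%E ->
    (kappa%:E <= nu [set u0])%E ->
  (\int[nu]_u f u <= (c - (c - c') * kappa + e)%:E)%E.
Proof.
move=> f01 fS fu0 /andP[c'_ge0 c'c] nuS nuu0.
have c_ge0 : 0 <= c by exact: le_trans c'c.
have cc' : 0 <= c - c' by rewrite subr_ge0.
have : (\int[nu]_u (f u + (c - c')%:E * (\1_[set u0] u)%:E) <=
        \int[nu]_u (c%:E + (\1_(~` S) u)%:E))%E.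
  apply: ge0_le_integral => //.
  - move=> u _; apply: adde_ge0; first by case/andP: (f01 u).
    by apply: mule_ge0; rewrite lee_fin.
  - move=> u _; rewrite indicE; have [->|uu0] := eqVneq u u0.
      rewrite mem_set// mule1.
      apply: (@le_trans _ _ (c'%:E + (c - c')%:E)%E); first exact: leeD2r.
      by rewrite -EFinD addrC subrK leeDl// lee_fin.
    rewrite memNset ?mule0 ?adde0; last by move/eqP: uu0.
    rewrite indicE; have [Su|nSu] := pselect (S u).
      by rewrite memNset ?adde0; [exact: fS|move=> /(_ Su)].
    rewrite mem_set//; case/andP: (f01 u) => _ /le_trans; apply.
    by rewrite -EFinD lee_fin lerDr.
rewrite !ge0_integralD//; first last.
- by move=> u _; apply: mule_ge0; rewrite lee_fin.
- by move=> u _; case/andP: (f01 u).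
rewrite ge0_integralZl//.
rewrite !integral_indic// integral_cst// !setIT.
rewrite [X in (_ <= _ * X + _)%E](_ : _ = 1%E) ?mule1 => [le|];
  last exact: probability_setT.
have {}le : (\int[nu]_u f u + ((c - c') * kappa)%:E <= (c + e)%:E)%E.
  apply: le_trans (le_trans le _); first by rewrite leeD2l// EFinM
    lee_wpmul2l// lee_fin.
  by rewrite EFinD leeD2l.
move: le; rewrite -leeBrDr// -EFinB => /le_trans; apply.
by rewrite lee_fin addrAC.
Qed.

Lemma finite_positive_lower_bound (I : finType) (f : I -> R) :
  (forall i, 0 < f i) -> exists2 kappa, 0 < kappa & forall i, kappa <= f i.
Proof.
move=> f_gt0; exists (\big[Num.min/1]_i f i); last by move=> i;
  exact: bigmin_le.
by elim/big_ind: _ => // x y x0 y0; rewrite lt_min x0.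
Qed.

Lemma probability_tail nu (f : G -> R) (e : R) : 0 < e ->
  exists K : R, (nu [set u | ~ (f u <= K)%R] <= e%:E)%E.
Proof.
move=> e_gt0; pose F n := [set u : discrete_group G | ~ (f u <= n%:R)].
have : nu (F n) @[n --> \oo] --> nu (\bigcap_n F n).
  apply: nonincreasing_cvg_mu => //.
    by rewrite ltey_eq fin_num_measure.
  move=> m n mn; apply/subsetPset => u /= Fn; apply: contra_not Fn =>
    /le_trans; apply.
  by rewrite ler_nat.
have -> : \bigcap_n F n = set0.
  apply/seteqP; split=> // u /(_ (Num.truncn (f u)).+1 I); apply.
  exact/ltW/truncnS_gt.
rewrite measure0 => /fine_cvgP[finF /cvgrPdist_le/(_ e e_gt0)].
move=> nearF; have [n _ Hn] := filterI finF nearF.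
have [fin le] := Hn n (leqnn n); exists n%:R.
rewrite -[X in (X <= _)%E]fineK// lee_fin (le_trans _ le)// sub0r normrN.
exact: ler_norm.
Qed.

End probability_on_discrete_group.

(** * Concentration of a convolution semigroup *)

Section concentration.
Context (R : realType) (G : groupType) (X : metricType R) (act : G -> X -> X).
Hypothesis actP : isometric_action act.
Context (lam : nat -> probability (discrete_group G) R).
Hypothesis lamD : forall m n (A : set (discrete_group G)),
  (lam (m + n) A = \int[lam m]_u lam n [set v | A (u * v)%g])%E.

Lemma convolution_pos m n (u v : discrete_group G) :
  (0 < lam m [set u])%E -> (0 < lam n [set v])%E ->
  (0 < lam (m + n) [set (u * v)%g])%E.
Proof.
move=> u_gt0 v_gt0; rewrite lamD.
apply: (@lt_le_trans _ _ (\int[lam m]_w (lam n [set v] * (\1_[set u] w)%:E))%E).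
  rewrite ge0_integralZl//.
  by rewrite integral_indic// setIT mule_gt0.
apply: ge0_le_integral => //.
- by move=> w _; rewrite mule_ge0.
- move=> w _; rewrite indicE; have [->|wu] := eqVneq w u; last first.
    by rewrite memNset ?mule0//; exact/eqP.
  by rewrite mem_set// mule1 le_measure ?inE// => _ ->.
Qed.

Lemma convolution_pos_exp m (u : discrete_group G) k :
  (0 < lam m [set u])%E -> (0 < lam (m * k.+1) [set (u ^+ k.+1)%g])%E.
Proof.
move=> u_gt0; elim: k => [|k IH]; first by rewrite muln1 expg1.
by rewrite mulnS expgS; exact: convolution_pos.
Qed.

Lemma convolution_pos_word s g h W c :
    (forall b, 0 < lam s [set ((letter g h b)^-1)%g : discrete_group G])%E ->
  (0 < lam (s * (size W).+1) [set ((word g h (rcons W c))^-1)%g :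
    discrete_group G])%E.
Proof.
move=> letter_gt0; elim: W => [|b W IH].
  by rewrite muln1 /word /= big_seq1.
by rewrite rcons_cons word_cons invgM mulnSr; exact: convolution_pos.
Qed.

(** The words have the same length in two letters whose inverses are charged at
    the same time, so all their inverses are charged at the common time [r]. The
    rightmost letter [c] is chosen according to [y], as the one that does not
    repel it; the other [t] letters are free. *)
Lemma spreading_words (delta L : R) (a b : G) o m n t :
    delta_hyperbolic X delta -> 0 <= delta ->
    loxodromic (act a) -> loxodromic (act b) ->
    boundary_fixed_points (act a) `&` boundary_fixed_points (act b) = set0 ->
    (0 < lam m.+1 [set (a^-1)%g : discrete_group G])%E ->
    (0 < lam n.+1 [set (b^-1)%g : discrete_group G])%E ->
  exists r (D : R) (u : bool -> t.-tuple bool -> discrete_group G),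
    (forall c W, 0 < lam r [set u c W])%E /\
    forall y, exists c, forall W W', W != W' ->
      gromov_product o (act (u c W)^-1%g y) (act (u c W')^-1%g y) <= D /\
      L < mdist (act (u c W)^-1%g y) (act (u c W')^-1%g y).
Proof.
move=> hypX delta_ge0 loxa loxb disj a_gt0 b_gt0.
have [p [q [E [p_gt0 q_gt0 schottky]]]] :=
  loxodromic_schottky_pair actP o hypX delta_ge0 loxa loxb disj.
(* [far] makes ping-pong work and keeps the images at distance more than [L]. *)
have [far EL LL] : exists2 far : R, 2 * E + 3 * delta + 1 <= far &
    L < 2 * far - 4 * E - 6 * delta.
  have L_le := ler_norm L.
  by exists (`|L| + `|2 * E + 3 * delta + 1| + 1);
    have := ler_norm (2 * E + 3 * delta + 1); have := normr_ge0 L; intros; lra.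
have [N schottkyN] := schottky far.
(* With these exponents both letters have inverses charged at the same time
   [s]. *)
pose i := (n.+1 * q * N.+1)%N; pose j := (m.+1 * p * N.+1)%N.
have Ni : (N <= i)%N by rewrite (leq_trans (leqnSn N))// leq_pmull// muln_gt0
  q_gt0.
have Nj : (N <= j)%N by rewrite (leq_trans (leqnSn N))// leq_pmull// muln_gt0
  p_gt0.
have {schottkyN schottky} sch := schottkyN i j Ni Nj.
set g := (a ^+ (p * i))%g in sch; set h := (b ^+ (q * j))%g in sch.
pose s := (m.+1 * (p * i))%N.
have sE : s = (n.+1 * (q * j))%N.
  rewrite /s /i /j !mulnA; congr (_ * _)%N.
  by rewrite -(mulnA (m.+1 * p)%N) mulnC mulnA.
have letter_gt0 c : (0 < lam s
  [set ((letter g h c)^-1)%g : discrete_group G])%E.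
  have pi_gt0 : (0 < p * i)%N by rewrite muln_gt0 p_gt0 !muln_gt0 q_gt0.
  have qj_gt0 : (0 < q * j)%N by rewrite muln_gt0 q_gt0 !muln_gt0 p_gt0.
  case: c; rewrite /letter.
    have := convolution_pos_exp (p * i).-1 a_gt0.
    by rewrite prednK// (_ : (_ ^+ _)%g = g^-1%g :> G) ?expVgn.
  have := convolution_pos_exp (q * j).-1 b_gt0.
  by rewrite prednK// -sE (_ : (_ ^+ _)%g = h^-1%g :> G) ?expVgn.
pose len := mdist o (act g o) + mdist o (act h o).
have letter_len c : mdist o (act (letter g h c) o) <= len.
  by case: c; rewrite /letter /len ?lerDl ?lerDr mdist_ge0.
exists (s * t.+1)%N, (E + 2 * delta + t%:R * len).
exists (fun c W => (word g h (rcons W c))^-1%g); split=> [c W|y].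
  by have := convolution_pos_word W c letter_gt0; rewrite size_tuple.
have [c yc] := schottky_first_letter y hypX sch.
exists c => W W' WW'; rewrite !invgK.
have WW'size : size W = size W' by rewrite !size_tuple.
have [] := schottky_words_separated actP hypX delta_ge0 sch EL letter_len yc
  WW'size WW'.
rewrite size_tuple => gp dist; split=> //; exact: lt_le_trans LL dist.
Qed.

(** The elements that move [o] towards [y] or close to [y]. The two conditions
    are treated together because translations and separated points act on both
    in the same way: the first bounds Gromov products, the second gives escape
    from bounded sets. *)
Definition near_set o y (M L : R) : set (discrete_group G) :=
  [set h | M < gromov_product o (act h o) y \/ mdist (act h o) y <= L].

(** The only effect of a translation by [u] is the change of the base point of
    the Gromov product from [o] to $u^{-1}o$. *)
Lemma near_set_translate o y (M K L : R) (u : G) : mdist o (act u o) <= K ->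
  [set v | near_set o y (M + K) L (u * v)%g] `<=`
  near_set o (act u^-1%g y) M L.
Proof.
move=> uK v /= [Mv|vL]; [left|right].
  have := gromov_product_base (act u^-1%g o) o (act v o) (act u^-1%g y).
  have := gromov_product_act actP u^-1%g o (act (u * v)%g o) y.
  rewrite (actM actP) (actK actP) => -> .
  rewrite -(mdist_actV actP).
  rewrite (actM actP) in Mv; intros; lra.
by rewrite (mdist_actV actP) invgK -(actM actP).
Qed.

Lemma near_set_disjoint (delta : R) o y z (M D L : R) :
    delta_hyperbolic X delta -> 0 <= delta -> 0 <= L ->
    gromov_product o y z <= D -> 2 * L < mdist y z -> D + delta + L <= M ->
  near_set o y M L `&` near_set o z M L = set0.
Proof.
move=> hypX delta_ge0 L_ge0 yz yzL DM; apply/seteqP; split=> // h [].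
set x := act h o; case=> hy; case=> hz.
- by have [] := four_point hypX o y z x; rewrite ?(gromov_productC o y x);
  intros; lra.
- have := gromov_product_move o y x z; rewrite (gromov_productC o y x).
  by intros; lra.
- have := gromov_product_move o z x y; rewrite (gromov_productC o z x)
  (gromov_productC o z y).
  by intros; lra.
- have := metric_triangle y x z; rewrite (metric_sym y x); intros; lra.
Qed.

Definition rarely_near o (L c : R) : Prop := exists (M : R) N, forall n y,
  (N <= n)%N -> (lam n (near_set o y M L) <= c%:E)%E.

Lemma rarely_near_le o (L c c' : R) : c <= c' -> rarely_near o L c ->
  rarely_near o L c'.
Proof.
move=> cc' [M [N H]]; exists M, N => n y Nn.
by rewrite (le_trans (H n y Nn))// lee_fin.
Qed.

Lemma common_upper_bound (x y : R) : exists z : R, x <= z /\ y <= z.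
Proof. by exists (Num.max x y); rewrite !le_max !lexx orbT. Qed.

(** The contraction step of the concentration argument; the point is that [eta]
    does not depend on [c]. *)
Lemma rarely_near_contract (delta L c0 : R) (a b : G) o m n :
    delta_hyperbolic X delta -> 0 <= delta -> 0 <= L -> 0 < c0 ->
    loxodromic (act a) -> loxodromic (act b) ->
    boundary_fixed_points (act a) `&` boundary_fixed_points (act b) = set0 ->
    (0 < lam m.+1 [set (a^-1)%g : discrete_group G])%E ->
    (0 < lam n.+1 [set (b^-1)%g : discrete_group G])%E ->
  exists2 eta : R, 0 < eta & forall c, c0 <= c ->
    rarely_near o L c -> rarely_near o L (c - eta).
Proof.
move=> hypX delta_ge0 L_ge0 c0_gt0 loxa loxb disj a_gt0 b_gt0.
(* Among $2^t$ disjoint events one has probability at most $c_0/2$. *)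
pose t := (Num.truncn (2 / c0)).+1.
have t_large : (2 ^ t)%:R^-1 <= c0 / 2 :> R.
  rewrite -[c0 / 2]invrK lef_pV2 ?posrE ?invr_gt0 ?divr_gt0 ?ltr0n ?expn_gt0//.
  rewrite invfM invrK mulrC ltW// (lt_le_trans (truncnS_gt _))// ler_nat.
  exact/ltnW/ltn_expl.
have [r [D [u [u_gt0 spread]]]] :=
  spreading_words (2 * L) o t hypX delta_ge0 loxa loxb disj a_gt0 b_gt0.
have [kappa kappa_gt0 kappa_le] : exists2 kappa : R, 0 < kappa &
    forall cW, kappa <= fine (lam r [set u cW.1 cW.2]).
  apply: finite_positive_lower_bound => -[c W] /=.
  by rewrite fine_gt0// u_gt0 ltey_eq fin_num_measure.
(* The gain $(c-c_0/2)\kappa$ is at least $2\eta$, and the tail of the first [r]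
   steps costs $\eta$. *)
pose eta := kappa * c0 / 4.
have eta_gt0 : 0 < eta by rewrite !mulr_gt0// invr_gt0.
exists eta => // c c0c [M [N MN]].
have [K0 tail] := probability_tail (lam r) (fun g => mdist o (act g o)) eta_gt0.
pose len := \sum_(cW : bool * t.-tuple bool) mdist o (act (u cW.1 cW.2) o).
have len_le c1 W : mdist o (act (u c1 W) o) <= len.
  rewrite /len (bigD1 (c1, W))//= lerDl sumr_ge0// => i _; exact: mdist_ge0.
have [K [K0K lenK]] := common_upper_bound K0 len.
have [M0 [MM0 DM0]] := common_upper_bound M (D + delta + L).
(* [K] absorbs the loss in a translation by any of the special elements and by
   all others outside the tail event; [M0] makes the events disjoint. *)
exists (M0 + K), (r + N)%N => k y rNk.
have [l rlk Nl] : exists2 l, k = (r + l)%N & (N <= l)%N.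
  exists (k - r)%N; first by rewrite subnKC// (leq_trans (leq_addr _ _) rNk).
  by rewrite leq_subRL// (leq_trans (leq_addr _ _) rNk).
rewrite rlk lamD.
have [c1 sep] := spread y.
have card_gt0 : (0 < #|{: t.-tuple bool}|)%N by rewrite card_tuple card_bool
  expn_gt0.
have disjW W W' : W != W' -> near_set o (act (u c1 W)^-1%g y) M0 L `&`
    near_set o (act (u c1 W')^-1%g y) M0 L = set0.
  move=> /sep[gp dist]; exact: (near_set_disjoint hypX delta_ge0 L_ge0 gp dist).
have [W0 W0_le] := small_among_disjoint (lam l) card_gt0 disjW.
rewrite card_tuple card_bool in W0_le.
have translate v : mdist o (act v o) <= K ->
    (lam l [set w | near_set o y (M0 + K) L (v * w)%g] <=
     lam l (near_set o (act v^-1%g y) M0 L))%E.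
  by move=> vK; rewrite le_measure ?inE//; exact: near_set_translate.
have M0M z : (lam l (near_set o z M0 L) <= lam l (near_set o z M L))%E.
  rewrite le_measure ?inE// => h [hz|hz];
    [left; exact: le_lt_trans hz|by right].
apply: (@le_trans _ _ (c - (c - c0 / 2) * kappa + eta)%:E).
  apply: (@integral_le_contraction _ _ _ _ [set v | mdist o (act v o) <= K]
    (u c1 W0)).
  - by move=> v; rewrite measure_ge0 probability_le1.
  - move=> v vK; rewrite (le_trans (translate v vK))// (le_trans (M0M _))//.
    exact: MN.
  - rewrite (le_trans (translate _ (le_trans (len_le c1 W0) lenK)))//.
    by rewrite (le_trans W0_le)// lee_fin.
  - by lra.
  - rewrite (le_trans _ tail)// le_measure ?inE// => v /=; apply: contra_not.
    by move=> /le_trans; apply.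
  - rewrite -[X in (_ <= X)%E]fineK ?fin_num_measure// lee_fin.
    exact: (kappa_le (c1, W0)).
rewrite lee_fin /eta -subr_ge0.
have -> : c - kappa * c0 / 4 - (c - (c - c0 / 2) * kappa + kappa * c0 / 4) =
  (c - c0) * kappa by field.
by rewrite mulr_ge0 ?subr_ge0// ltW.
Qed.

(** Uniformity in the point [y] is essential: it allows the estimate to be
    applied with [y] depending on an independent random variable. *)
Theorem concentration (delta L eps : R) (a b : G) o m n :
    delta_hyperbolic X delta -> 0 <= delta -> 0 <= L -> 0 < eps ->
    loxodromic (act a) -> loxodromic (act b) ->
    boundary_fixed_points (act a) `&` boundary_fixed_points (act b) = set0 ->
    (0 < lam m.+1 [set (a^-1)%g : discrete_group G])%E ->
    (0 < lam n.+1 [set (b^-1)%g : discrete_group G])%E ->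
  rarely_near o L eps.
Proof.
move=> hypX delta_ge0 L_ge0 eps_gt0 loxa loxb disj a_gt0 b_gt0.
have [eta eta_gt0 contract] :=
  rarely_near_contract o hypX delta_ge0 L_ge0 eps_gt0 loxa loxb disj a_gt0
    b_gt0.
(* The contraction is available above [eps] only, hence the maximum. *)
have iterate k : rarely_near o L (Num.max eps (1 - k%:R * eta)).
  elim: k => [|k IH].
    exists 0, 0%N => k y _; rewrite (le_trans (probability_le1 _ _))//.
    by rewrite lee_fin le_max mul0r subr0 lexx orbT.
  have [small|large] := leP (1 - k%:R * eta) eps.
    apply: rarely_near_le IH; rewrite (max_idPl small) le_max lexx//.
  rewrite (max_idPr (ltW large)) in IH.
  apply: rarely_near_le (contract _ (ltW large) IH).
  by rewrite le_max -natr1 mulrDl mul1r opprD addrA lexx orbT.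
have /max_idPl <- : 1 - (Num.truncn (1 / eta)).+1%:R * eta <= eps;
  last exact: iterate.
apply: (@le_trans _ _ 0); last exact: ltW.
by rewrite subr_le0 -ler_pdivrMr// ltW// truncnS_gt.
Qed.

End concentration.

(** * Laws of walks and finite families of events *)

Section laws_of_walks.
Context (R : realType) (G : groupType).
Hypothesis G_countable : countable [set: G].
Context (mu : probability (discrete_group G) R).
Context (d : measure_display) (Omega : measurableType d)
  (P : probability Omega R).

Definition discrete_mfun (f : Omega -> discrete_group G)
    (mf : forall B : set (discrete_group G), measurable
      [set omega | B (f omega)]) :
    {mfun Omega >-> discrete_group G}.
Proof.
by apply: (@mfun_Sub _ _ _ _ f); rewrite inE => _ B _; rewrite setTI; exact: mf.
Defined.

(** A bound that is uniform in the value of one variable survives conditioning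
    on it. *)
Lemma independent_pair_le (U V : {mfun Omega >-> discrete_group G})
    (B : discrete_group G -> set (discrete_group G)) (e : R) :
    (forall u C, P (U @^-1` [set u] `&` V @^-1` C) = P (U @^-1` [set u]) * P
      (V @^-1` C))%E ->
    (forall u, P (V @^-1` (B u)) <= e%:E)%E ->
  (P [set omega | B (U omega) (V omega)] <= e%:E)%E.
Proof.
move=> UV VB.
have mV C : measurable (V @^-1` C).
  by rewrite -[X in measurable X]setTI; exact: measurable_funP.
rewrite (disintegration (P := P) G_countable (U := U)
  (F := fun u => V @^-1` (B u)) (phi := fun u => P (V @^-1` (B u))))//.
apply: (@le_trans _ _ (\int[distribution P U]_u (cst e%:E) u)%E).
  exact: ge0_le_integral.
by rewrite integral_cst// [X in (_ * X)%E](_ : _ = 1%E) ?mule1//;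
  exact: probability_setT.
Qed.

Context (g : nat -> {RV P >-> discrete_group G}).
Hypothesis g_indep : mutually_independent P
  (fun i => g_sigma_algebra_preimage (g i)).
Hypothesis g_law : forall i, distribution P (g i) =1 mu.

Let law := walk_law mu.
Let blockE := walk_lawE G_countable g_indep g_law.
Let pairE := block_pair_law G_countable g_indep g_law.
Let mblock := @measurable_block_preimage R G G_countable d Omega P g.

Definition block_mfun m n : {mfun Omega >-> discrete_group G} :=
  discrete_mfun (mblock m n).

Definition blockV_mfun m n : {mfun Omega >-> discrete_group G} :=
  discrete_mfun (f := fun omega => (block g m n omega)^-1%g)
    (fun B => mblock m n [set v | B v^-1%g]).

Lemma forward_law_convolution m n (A : set (discrete_group G)) :
  (distribution P (block_mfun 0 (m + n)) A =
   \int[distribution P (block_mfun 0 m)]_u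
     distribution P (block_mfun 0 n) [set v | A (u * v)%g])%E.
Proof.
rewrite -(disintegration (P := P) G_countable (U := block_mfun 0 m)
  (F := fun u => [set omega | A (u * block g m n omega)%g])).
- by congr (P _); apply/seteqP; split=> omega /=; rewrite block_cat.
- by move=> u; exact: (mblock m n [set v | A (u * v)%g]).
- by move=> u; exact: measure_ge0.
- move=> u; rewrite /distribution /pushforward.
  have := pairE m n [set u] [set v | A (u * v)%g] => /= ->.
  by rewrite -(blockE 0 m) -(blockE 0 n).
Qed.

(** The inverse $w_{n+m}^{-1}=b^{-1}w_n^{-1}$ starts with the inverse of the
    last block $b$ of [m] increments, which is independent of $w_n$. *)
Lemma backward_law_convolution m n (A : set (discrete_group G)) :
  (distribution P (blockV_mfun 0 (m + n)) A =
   \int[distribution P (blockV_mfun 0 m)]_u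
     distribution P (blockV_mfun 0 n) [set v | A (u * v)%g])%E.
Proof.
have -> : distribution P (blockV_mfun 0 (m + n)) A =
    P [set omega | A ((block g n m omega)^-1 * (block g 0 n omega)^-1)%g].
  by rewrite addnC; congr (P _); apply/seteqP; split=> omega /=;
    rewrite block_cat invgM.
have lawV : distribution P (blockV_mfun n m) =1 distribution P
  (blockV_mfun 0 m).
  move=> B; rewrite /distribution /pushforward/=.
  by have := blockE n m [set v | B v^-1%g]; rewrite -(blockE 0 m).
rewrite (disintegration (P := P) G_countable (U := blockV_mfun n m)
  (F := fun u => [set omega | A (u * (block g 0 n omega)^-1)%g])
  (phi := fun u => distribution P (blockV_mfun 0 n) [set v | A (u * v)%g])).
- by apply: eq_measure_integral => B _ _; exact: lawV.
- by move=> u; exact: (mblock 0 n [set v | A (u * v^-1)%g]).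
- by move=> u; exact: measure_ge0.
- move=> u; rewrite /distribution /pushforward setIC.
  have := pairE n m [set v | A (u * v^-1)%g] [set v | v^-1 = u]%g => /= ->.
  by rewrite muleC -(blockE 0 n) -(blockE n m).
Qed.

End laws_of_walks.

Section support.
Context (R : realType) (G : groupType).
Context (lam : nat -> probability (discrete_group G) R).
Hypothesis lamD : forall m n (A : set (discrete_group G)),
  (lam (m + n) A = \int[lam m]_u lam n [set v | A (u * v)%g])%E.

(** The elements charged by some [lam n] with [0 < n] form a semigroup. *)
Lemma generated_semigroup_charged (g : G) :
    generated_semigroup (measure_support (lam 1)) g ->
  exists n, (0 < lam n.+1 [set g : discrete_group G])%E.
Proof.
move=> /(_ [set g | exists n, (0 < lam n.+1 [set g : discrete_group G])%E]);
  apply.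
split=> [u v [m um] [n vn]|u um]; last by exists 0%N.
exists (m + n.+1)%N; rewrite -addSn; exact: convolution_pos.
Qed.

End support.

Section union_bound.
Context (d : measure_display) (Omega : measurableType d) (R : realType)
  (P : probability Omega R).

Lemma union_bound (I : finType) (A : I -> set Omega) (e : R) :
    (forall i, measurable (A i)) -> (forall i, P (A i) <= e%:E)%E ->
  (P (\bigcup_i A i) <= (#|I|%:R * e)%:E)%E.
Proof.
move=> mA PA.
rewrite (_ : \bigcup_i A i = \big[setU/set0]_(i <- enum I) A i); last first.
  rewrite -bigcup_seq; apply: eq_bigcupl; split=> i //= _.
  by rewrite mem_enum.
rewrite cardE; elim: (enum I) => [|i r IH]; first by rewrite big_nil measure0
  mul0r.
rewrite big_cons /= -natr1 mulrDl mul1r addrC EFinD.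
apply: le_trans; last exact: leeD (PA i) IH.
by apply: measureU2 => //; exact: bigsetU_measurable.
Qed.

(** Every property of finitely many variables with countably many values is
    measurable, whatever its complexity; this applies to the quasi-isometry
    property of the orbit map. *)
Lemma measurable_finite_family (G : groupType) k
    (w : 'I_k -> Omega -> discrete_group G)
      (Q : set ('I_k -> discrete_group G)) :
    countable [set: G] -> (forall j, measurable_fun setT (w j)) ->
  measurable [set omega | Q (fun j => w j omega)].
Proof.
move=> G_countable mw.
have [e e_inj] := countable_injective G_countable.
rewrite (_ : [set _ | _] = \bigcup_(t : {ffun 'I_k -> nat})
    [set omega | Q (fun j => w j omega) /\ forall j, e (w j omega) = t j]);
      last first.
  apply/seteqP; split=> [omega Qo|omega [t _ []]//].
  by exists [ffun j => e (w j omega)] => //; split=> // j; rewrite ffunE.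
apply: countable_bigcupT_measurable => [|t]; first exact: countableP.
have [[omega0 [Q0 t0]]|none] := pselect (exists omega,
    Q (fun j => w j omega) /\ forall j, e (w j omega) = t j); last first.
  by rewrite (_ : [set _ | _] = set0)//; apply/seteqP; split=> // omega Ho;
    apply: none; exists omega.
rewrite (_ : [set _ | _] = \bigcap_(j in [set: 'I_k])
  (w j @^-1` [set w j omega0])).
  apply: fin_bigcap_measurable => // j _; rewrite -[X in measurable X]setTI;
    exact: mw.
apply/seteqP; split=> [omega [_ to] j _|omega wo].
  by apply: e_inj; rewrite to t0.
have woE : (fun j => w j omega) = (fun j => w j omega0) by apply/funext => j;
  exact: wo.
by split=> [|j] /=; [rewrite woE|rewrite (wo j I) t0].
Qed.

End union_bound.

(** * Random walks on a hyperbolic space *)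

Section random_walk.
Context (R : realType) (G : groupType) (X : metricType R) (act : G -> X -> X).
Hypothesis actP : isometric_action act.
Hypothesis G_countable : countable [set: G].
Context (mu : probability (discrete_group G) R).
Context (d : measure_display) (Omega : measurableType d)
  (P : probability Omega R).

Lemma random_walk_law (w : nat -> Omega -> discrete_group G) :
    random_walk P mu w ->
  forall n (B : set (discrete_group G)), measurable [set omega | B (w n omega)]
    /\
    P [set omega | B (w n omega)] = walk_law mu n B.
Proof.
move=> [g [g_indep g_law wE]] n B.
have -> : [set omega | B (w n omega)] = [set omega | B (block g 0 n omega)].
  by apply/seteqP; split=> omega /=; rewrite wE.
by split; [exact: measurable_block_preimage|exact: walk_lawE].
Qed.

(** The estimate for $w_n$ uses that $a^{-1},b^{-1}$ are charged, the one for
    $w_n^{-1}$ that $a,b$ are: this is where the semigroup generated by the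
    support is required to be a group. *)
Lemma walk_law_concentration (w : nat -> Omega -> discrete_group G)
    (delta L eps : R) o :
    random_walk P mu w -> nonelementary_measure act mu ->
    delta_hyperbolic X delta -> 0 <= delta -> 0 <= L -> 0 < eps ->
  exists (M : R) N, forall n y, (N <= n)%N ->
    (walk_law mu n (near_set act o y M L) <= eps%:E)%E /\
    (walk_law mu n [set v | near_set act o y M L v^-1%g] <= eps%:E)%E.
Proof.
move=> [g [g_indep g_law _]] [[_ _ HV] [a [b [Ha Hb loxa loxb disj]]]].
move=> hypX delta_ge0 L_ge0 eps_gt0.
have lawE := walk_lawE G_countable g_indep g_law.
pose lam n : probability (discrete_group G) R :=
  distribution P (block_mfun G_countable g 0 n).
pose lamV n : probability (discrete_group G) R :=
  distribution P (blockV_mfun G_countable g 0 n).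
have lamE n B : lam n B = walk_law mu n B by exact: lawE.
have lamVE n B : lamV n B = walk_law mu n [set v | B v^-1%g].
  exact: (lawE 0 n [set v | B v^-1%g]).
have lamD m n A := forward_law_convolution G_countable g_indep g_law m n A.
have lamVD m n A := backward_law_convolution G_countable g_indep g_law m n A.
have charged h : generated_semigroup (measure_support mu) h ->
    exists n, (0 < walk_law mu n.+1 [set h : discrete_group G])%E.
  rewrite (_ : measure_support mu = measure_support (lam 1)); last first.
    apply/seteqP; split=> v; rewrite /measure_support /= lamE;
      by rewrite (walk_law1 G_countable g_indep g_law).
  by move=> /(generated_semigroup_charged (lam := lam) lamD)[n]; rewrite lamE;
    exists n.
have [m1 a1_gt0] := charged _ (HV _ Ha); have [n1 b1_gt0] := charged _
  (HV _ Hb).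
have [m2 a2_gt0] := charged _ Ha; have [n2 b2_gt0] := charged _ Hb.
have set1V (h : discrete_group G) : [set v | [set h^-1%g] v^-1%g] = [set h] :>
  set (discrete_group G).
  by apply/seteqP; split=> v /= [] => [/invg_inj|->].
rewrite -lamE in a1_gt0; rewrite -lamE in b1_gt0.
rewrite -set1V -lamVE in a2_gt0; rewrite -set1V -lamVE in b2_gt0.
have [M1 [N1 near1]] := concentration actP (lam := lam) lamD o hypX delta_ge0
  L_ge0 eps_gt0 loxa loxb disj a1_gt0 b1_gt0.
have [M2 [N2 near2]] := concentration actP (lam := lamV) lamVD o hypX delta_ge0
  L_ge0 eps_gt0 loxa loxb disj a2_gt0 b2_gt0.
exists (Num.max M1 M2), (maxn N1 N2) => n y; rewrite geq_max => /andP[N1n N2n].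
have mono (M : R) : M <= Num.max M1 M2 ->
    near_set act o y (Num.max M1 M2) L `<=` near_set act o y M L.
  by move=> le h [lt|near]; [left; exact: le_lt_trans lt|right].
rewrite -lamE -lamVE; split.
- apply: le_trans (near1 n y N1n); rewrite le_measure ?inE//; apply: mono.
  by rewrite le_max lexx.
- apply: le_trans (near2 n y N2n); rewrite le_measure ?inE//; apply: mono.
  by rewrite le_max lexx orbT.
Qed.

(** From [o], the point $uvo$ lies in the direction of $uo$ and $(uv)^{-1}o$ in
    that of $v^{-1}o$, because $(uvo\cdot uo)_o=|u|-(u^{-1}o\cdot vo)_o$ is
    large, and likewise for the inverse. The directions of $uo$ and $v^{-1}o$
    differ by hypothesis. *)
Lemma gromov_product_inverse_le (delta M L : R) (u v : G) o :
    delta_hyperbolic X delta -> 0 <= delta ->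
    gromov_product o (act u^-1%g o) (act v o) <= M ->
    gromov_product o (act u o) (act v^-1%g o) <= M ->
    L < mdist o (act u o) -> L < mdist o (act v o) -> 2 * M + 2 * delta <= L ->
  gromov_product o (act (u * v)%g o) (act (u * v)^-1%g o) <= M + 2 * delta.
Proof.
move=> hypX delta_ge0 uv vu Lu Lv ML.
have near_u : L - M < gromov_product o (act u o) (act (u * v)%g o).
  rewrite gromov_product_switch -(gromov_product_act actP u^-1%g).
  by rewrite !(actK actP) (actM actP) (actK actP); lra.
have near_v : L - M < gromov_product o (act v^-1%g o) (act (u * v)^-1%g o).
  rewrite gromov_product_switch -(gromov_product_act actP v).
  rewrite (actVK actP) invgM (actM actP) (actVK actP) gromov_productC.
  by rewrite (mdist_actV actP) invgK metric_sym; lra.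
have [] := four_point hypX o (act u o) (act v^-1%g o) (act (u * v)%g o).
  by intros; lra.
have [] := four_point hypX o (act (u * v)%g o) (act v^-1%g o)
  (act (u * v)^-1%g o).
  by intros; lra.
by rewrite (gromov_productC o (act (u * v)^-1%g o)); intros; lra.
Qed.

(** The walk is cut at time [n./2]; the two halves are independent, and outside
    four rare events they satisfy the hypotheses of
    [gromov_product_inverse_le]. *)
Lemma random_walk_inverse_separated (w : nat -> Omega -> discrete_group G)
    (delta M L eps : R) N n o :
    random_walk P mu w -> delta_hyperbolic X delta -> 0 <= delta ->
    2 * M + 2 * delta <= L -> (2 * N <= n)%N ->
    (forall m y, (N <= m)%N ->
      (walk_law mu m [set v | (M < gromov_product o (act v o) y)%R] <=
        eps%:E)%E) ->
    (forall m y, (N <= m)%N ->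
      (walk_law mu m [set v | (M < gromov_product o (act v^-1%g o) y)%R] <=
        eps%:E)%E) ->
    (forall m, (N <= m)%N ->
      (walk_law mu m [set v | (mdist o (act v o) <= L)%R] <= eps%:E)%E) ->
  (P [set omega | (M + 2 * delta < gromov_product o (act (w n omega) o)
     (act (w n omega)^-1%g o))%R] <= (4 * eps)%:E)%E.
Proof.
move=> [g [g_indep g_law wE]] hypX delta_ge0 ML Nn rare rareV rareL.
have lawE := walk_lawE G_countable g_indep g_law.
have Nh : (N <= n./2)%N by rewrite -(doubleK N) half_leq// -mul2n.
have Nu : (N <= n - n./2)%N.
  by rewrite (leq_trans Nh)// leq_subRL ?addnn -?divn2 ?leq_div//;
    rewrite -{2}(odd_double_half n) divn2 leq_addl.
set m := n./2 in Nh Nu; set m' := (n - m)%N in Nu.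
have mm' : n = (m + m')%N by rewrite /m' subnKC// /m -divn2 leq_div.
pose U := block_mfun G_countable g 0 m; pose V := block_mfun G_countable g m m'.
have UV u C : (P (U @^-1` [set u] `&` V @^-1` C) = P (U @^-1` [set u]) * P
  (V @^-1` C))%E.
  have := block_pair_law G_countable g_indep g_law m m' [set u] C => /= ->.
  by rewrite -(lawE 0 m) -(lawE m m').
pose E (pq : bool * bool) : set Omega := match pq with
  | (true, true) => [set omega |
    (M < gromov_product o (act (V omega) o) (act (U omega)^-1%g o))%R]
  | (true, false) => [set omega |
    (M < gromov_product o (act (V omega)^-1%g o) (act (U omega) o))%R]
  | (false, true) => [set omega | (mdist o (act (U omega) o) <= L)%R]
  | (false, false) => [set omega | (mdist o (act (V omega) o) <= L)%R] end.
have mE pq : measurable (E pq).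
  case: pq => [[] []] /=.
  - apply: (measurable_fibers G_countable U
      (F := fun u => [set omega | (M < gromov_product o (act (V omega) o)
        (act u^-1%g o))%R])) => u.
    exact: (measurable_block_preimage G_countable g m m'
        [set v | (M < gromov_product o (act v o) (act u^-1%g o))%R]).
  - apply: (measurable_fibers G_countable U
      (F := fun u => [set omega | (M < gromov_product o (act (V omega)^-1%g o)
        (act u o))%R])) => u.
    exact: (measurable_block_preimage G_countable g m m'
        [set v | (M < gromov_product o (act v^-1%g o) (act u o))%R]).
  - exact: (measurable_block_preimage G_countable g 0 m
    [set v | (mdist o (act v o) <= L)%R]).
  - exact: (measurable_block_preimage G_countable g m m'
    [set v | (mdist o (act v o) <= L)%R]).
have PE pq : (P (E pq) <= eps%:E)%E.
  case: pq => [[] []] /=.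
  - apply: (independent_pair_le G_countable (U := U) (V := V)
      (B := fun u => [set v | (M < gromov_product o (act v o)
        (act u^-1%g o))%R])) => // u.
    by have := lawE m m' [set v | (M < gromov_product o (act v o)
      (act u^-1%g o))%R] => /= ->; exact: rare.
  - apply: (independent_pair_le G_countable (U := U) (V := V)
      (B := fun u => [set v | (M < gromov_product o (act v^-1%g o)
        (act u o))%R])) => // u.
    by have := lawE m m' [set v | (M < gromov_product o (act v^-1%g o)
      (act u o))%R] => /= ->; exact: rareV.
  - by have := lawE 0%N m [set v | (mdist o (act v o) <= L)%R] => /= ->;
    exact: rareL.
  - by have := lawE m m' [set v | (mdist o (act v o) <= L)%R] => /= ->;
    exact: rareL.
have mbad : measurable [set omega |
  (M + 2 * delta < gromov_product o (act (w n omega) o)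
     (act (w n omega)^-1%g o))%R].
  rewrite (_ : [set _ | _] = [set omega |
    [set v | (M + 2 * delta < gromov_product o (act v o)
     (act v^-1%g o))%R] (block g 0 n omega)]); first exact:
       measurable_block_preimage.
  by apply/seteqP; split=> omega /=; rewrite wE.
have := union_bound mE PE; rewrite card_prod card_bool => /(le_trans _); apply.
rewrite le_measure ?inE//; first by apply: fin_bigcup_measurable.
move=> omega /= bad; apply: contrapT => good.
have notE pq : ~ E pq omega by move=> Epq; apply: good; exists pq.
move: bad; apply/negP; rewrite -leNgt.
have -> : w n omega = (block g 0 m omega * block g m m' omega)%g.
  by rewrite wE mm' -[LHS]/(block g 0 (m + m') omega) block_cat.
have /negP := notE (true, true); rewrite -leNgt => gp1.
have /negP := notE (true, false); rewrite -leNgt => gp2.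
have /negP := notE (false, true); rewrite -ltNge => len1.
have /negP := notE (false, false); rewrite -ltNge => len2.
apply: (gromov_product_inverse_le hypX delta_ge0 _ _ len1 len2 ML).
- by rewrite gromov_productC.
- by rewrite gromov_productC.
Qed.

End random_walk.

(** * The orbit map of the group generated by independent walks *)

Lemma independent_processes_pair (d : measure_display) (R : realType)
    (G : groupType) (Omega : measurableType d) (P : probability Omega R) k
    (w : 'I_k -> nat -> Omega -> discrete_group G) i j n
    (A B : set (discrete_group G)) :
    independent_processes P w -> i != j ->
  (P (w j n @^-1` A `&` w i n @^-1` B) = P (w j n @^-1` A) * P
    (w i n @^-1` B))%E.
Proof.
move=> w_indep ij.
pose F l := w l n @^-1` (if l == i then B else A).
have := w_indep (j |` [fset i])%fset F _.
rewrite set_fsetU1 set_fset1 bigcap_setU1 bigcap_set1.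
rewrite big_fsetU1/= ?inE ?(eq_sym j)// big_seq_fset1.
rewrite /F eqxx eq_sym (negbTE ij); apply => l _.
apply: sub_sigma_algebra; exists n => //.
by exists (if l == i then B else A) => //; rewrite setTI.
Qed.

Lemma cvg_probability1 (d : measure_display) (R : realType)
    (Omega : measurableType d) (P : probability Omega R) (Q : nat -> set Omega)
      :
    (forall n, measurable (Q n)) ->
    (forall e : R, 0 < e -> exists N, forall n, (N <= n)%N ->
      (P (~` Q n) <= e%:E)%E) ->
  P (Q n) @[n --> \oo] --> 1%E.
Proof.
move=> mQ small; apply/fine_cvgP; split.
  by near=> n; exact: fin_num_measure.
apply/cvgrPdist_le => e e_gt0; have [N smallN] := small e e_gt0.
exists N => // n /= Nn; have := smallN n Nn.
rewrite probability_setC// -[P (Q n)]fineK ?fin_num_measure// -EFinB lee_fin /=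
  => le.
rewrite ger0_norm// subr_ge0 -lee_fin fineK ?fin_num_measure//.
exact: probability_le1.
Unshelve. all: by end_near. Qed.

Theorem theorem1p2 (R : realType) (G : groupType) (X : metricType R)
    (act : G -> X -> X)
    (G_countable : countable [set: G])
    (X_separable : separable_space X)
    (X_hyperbolic : hyperbolic X)
    (act_isometric : isometric_action act)
    (act_nonelementary : nonelementary_action act [set: G])
    (mu : probability (discrete_group G) R)
    (mu_nonelementary : nonelementary_measure act mu)
    (k : nat) (k_ge1 : (1 <= k)%N) (x0 : X)
    (d : measure_display) (Omega : measurableType d) (P : probability Omega R)
    (w : 'I_k -> nat -> Omega -> discrete_group G)
    (w_random_walk : forall j, random_walk P mu (w j))
    (w_independent : independent_processes P w) :
  P [set omega |
      let S : set G := range (fun j => w j n omega) in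
      quasi_isometric_embedding (generated_subgroup S) (word_metric R S)
        (fun g => act g x0)]
    @[n --> \oo] --> 1%E.
Proof.
have [delta [delta_ge0 hypX]] := X_hyperbolic.
have mw j n : measurable_fun setT (w j n).
  by move=> _ B _; rewrite setTI; exact:
    (random_walk_law G_countable (w_random_walk j) n B).1.
have wE j n B := (random_walk_law G_countable (w_random_walk j) n B).2.
have mQ n (Q : set ('I_k -> discrete_group G)) : measurable
  [set omega | Q (fun j => w j n omega)].
  exact: measurable_finite_family.
have mQI n := mQ n (fun s => quasi_isometric_embedding
  (generated_subgroup (range s)) (word_metric R (range s)) (fun g => act g x0)).
apply: cvg_probability1 => [n|e e_gt0]; first exact: mQI.
pose I := (('I_k * bool) * ('I_k * bool))%type.
(* Each of the [#|I|] bad events below costs at most [4 * eps]. *)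
pose eps := e / (4 * (#|{: I}|%:R + 1)).
have eps_gt0 : 0 < eps by rewrite divr_gt0// mulr_gt0// ltr_wpDl.
pose j0 : 'I_k := Ordinal k_ge1.
have [M1 [N1 near1]] := walk_law_concentration act_isometric G_countable x0
  (w_random_walk j0) mu_nonelementary hypX delta_ge0 (lexx 0) eps_gt0.
have [M [M_ge0 M1M]] := common_upper_bound 0 M1.
pose L : R := 2 * (M + 2 * delta) + 3 * delta + 1.
have L_ge0 : 0 <= L by rewrite /L; lra.
have [M2 [N2 near2]] := walk_law_concentration act_isometric G_countable x0
  (w_random_walk j0) mu_nonelementary hypX delta_ge0 L_ge0 eps_gt0.
have rare p m y : (N1 <= m)%N -> (walk_law mu m
    [set v | (M < gromov_product x0 (act (signed p v) x0) y)%R] <= eps%:E)%E.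
  move=> N1m; have [le leV] := near1 m y N1m.
  by case: p; [apply: le_trans le|apply: le_trans leV];
    apply: walk_law_le => v /= Mv;
    left; exact: le_lt_trans Mv.
have rareL m : (N2 <= m)%N ->
    (walk_law mu m [set v | (mdist x0 (act v x0) <= L)%R] <= eps%:E)%E.
  move=> N2m; have [le _] := near2 m x0 N2m; apply: le_trans le.
  by apply: walk_law_le => v vL; right; rewrite metric_sym.
pose N := maxn N1 N2; exists (2 * N)%N => n Nn.
have N_n : (N <= n)%N by rewrite (leq_trans _ Nn)// leq_pmull.
have N1n : (N1 <= n)%N by rewrite (leq_trans (leq_maxl _ _) N_n).
have N2n : (N2 <= n)%N by rewrite (leq_trans (leq_maxr _ _) N_n).
(* The diagonal of the index set is free, as a letter is never compared with
   itself; it carries the events on the length of the letters. *)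
pose badQ (x : I) : set ('I_k -> discrete_group G) :=
  if x.1 == x.2 then [set s | (mdist x0 (act (s x.1.1) x0) <= L)%R]
  else [set s | (M + 2 * delta < gromov_product x0
    (act (signed x.1.2 (s x.1.1)) x0) (act (signed x.2.2 (s x.2.1)) x0))%R].
pose bad x : set Omega := [set omega | badQ x (fun j => w j n omega)].
have mbad x : measurable (bad x) by exact: mQ.
have bad_le x : (P (bad x) <= (4 * eps)%:E)%E.
  have eps_le : (eps%:E <= (4 * eps)%:E)%E by rewrite lee_fin; lra.
  rewrite /bad /badQ; case: x => [[i p] [j q]] /=.
  case: ifPn => [_|].
    apply: le_trans eps_le; have := wE i n
      [set v | (mdist x0 (act v x0) <= L)%R].
    by move=> /= ->; exact: rareL.
  rewrite xpair_eqE; have [<- /= pq|ij _] := eqVneq i j.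
    have sep : (P [set omega | (M + 2 * delta < gromov_product x0
        (act (w i n omega) x0) (act (w i n omega)^-1%g x0))%R] <=
          (4 * eps)%:E)%E.
      apply: (random_walk_inverse_separated act_isometric G_countable (L := L)
        (N := N) (w_random_walk i) hypX delta_ge0) => //.
      - by rewrite /L; lra.
      - by move=> m y; rewrite geq_max => /andP[N1m _]; exact: (rare true).
      - by move=> m y; rewrite geq_max => /andP[N1m _]; exact: (rare false).
      - by move=> m; rewrite geq_max => /andP[_]; exact: rareL.
    case: p q pq => [] [] // _.
    by rewrite (_ : [set _ | _] = [set omega |
      (M + 2 * delta < gromov_product x0
        (act (w i n omega) x0) (act (w i n omega)^-1%g x0))%R])//;
      apply/seteqP; split=> omega /=; rewrite gromov_productC.
  apply: le_trans eps_le.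
  pose U := discrete_mfun (fun B =>
    (random_walk_law G_countable (w_random_walk j) n B).1).
  pose V := discrete_mfun (fun B =>
    (random_walk_law G_countable (w_random_walk i) n B).1).
  apply: (independent_pair_le G_countable (U := U) (V := V) (B := fun u =>
    [set v | (M + 2 * delta < gromov_product x0 (act (signed p v) x0)
      (act (signed q u) x0))%R])).
    by move=> u C; exact: independent_processes_pair.
  move=> u; have := wE i n [set v | (M + 2 * delta < gromov_product x0
    (act (signed p v) x0) (act (signed q u) x0))%R] => /= ->.
  apply: le_trans (rare p n (act (signed q u) x0) N1n).
  by apply: walk_law_le => v /=; apply: le_lt_trans; rewrite lerDl mulr_ge0.
apply: (@le_trans _ _ (P (\bigcup_x bad x))).
  rewrite le_measure ?inE//; first exact: measurableC (mQI n).
    by apply: fin_bigcup_measurable => [|x _];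
      [exact: finite_finset|exact: mbad].
  move=> omega; apply: contra_notP => good.
  have notbad x : ~ bad x omega by move=> badx; apply: good; exists x.
  apply: (separated_quasi_isometric_embedding act_isometric
    (M := M + 2 * delta) hypX delta_ge0).
  - by rewrite addr_ge0// mulr_ge0.
  - move=> j; have := notbad ((j, true), (j, true)).
    by rewrite /bad /badQ /= eqxx => /negP; rewrite -ltNge => /ltW.
  - move=> i j p q g h gh; have := notbad ((i, p), (j, q)).
    rewrite /bad /badQ /=; case: ifPn => [/eqP[ij pq]|_ /negP];
      last by rewrite -leNgt.
    by move: gh; rewrite /g /h ij pq eqxx.
apply: le_trans (union_bound mbad bad_le) _; rewrite lee_fin.
rewrite /eps; set c : R := (#|{: I}|)%:R.
have c1_gt0 : 0 < c + 1 by rewrite ltr_wpDl.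
have -> : c * (4 * (e / (4 * (c + 1)))) = c / (c + 1) * e.
  by field; rewrite gt_eqF.
by rewrite ler_piMl ?ltW// ltr_pdivrMr// mul1r ltrDl.
Qed.
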